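(* Let $p$ be a prime and $r\in\mathbb{N}$. For $n_1,\ldots,n_r\in\mathbb{N}_0$, $\gamma_1,\ldots,\gamma_r\in\mathbb{Z}_p$ and $c\in\mathbb{N}_{>1}$ with $(c,p)=1$, \begin{align*} &L_{p,r}(-n_1,\ldots,-n_r;\omega^{n_1},\ldots,\omega^{n_r};\gamma_1,\ldots,\gamma_r;c)\\ &=\sum_{\substack{\xi_1^c=1\\ \xi_1\neq1}}\cdots\sum_{\substack{\xi_r^c=1\\ \xi_r\neq1}}\mathfrak{B}((n_j);(\xi_j);(\gamma_j))\\ &\quad+\sum_{d=1}^r\left(-\frac1p\right)^d\sum_{1\leqslant i_1<\cdots<i_d\leqslant r}\ \sum_{\rho_{i_1}^p=1}\cdots\sum_{\rho_{i_d}^p=1}\ \sum_{\substack{\xi_1^c=1\\ \xi_1\neq1}}\cdots\sum_{\substack{\xi_r^c=1\\ \xi_r\neq1}}\mathfrak{B}\Bigl((n_j);\Bigl(\bigl(\prod_{j\leqslant i_l}\rho_{i_l}\bigr)^{\gamma_j}\xi_j\Bigr);(\gamma_j)\Bigr), \end{align*} where, for each $j$, the product $\prod_{j\leqslant i_l}\rho_{i_l}$ runs over those $l\in\{1,\ldots,d\}$ with $i_l\geqslant j$, and the empty product is interpreted as $1$.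
   Context: $\mathbb{N}_0=\{0,1,2,\dots\}$. All roots of unity are in $\mathbb{C}_p$; for $\rho^p=1$ and $\gamma\in\mathbb{Z}_p$, $\rho^\gamma=\rho^a$ for any integer $a\equiv\gamma\bmod p$. For roots of unity $\xi_1,\ldots,\xi_r\in\mathbb{C}_p\setminus\{1\}$ and $\gamma_1,\ldots,\gamma_r\in\mathbb{Z}_p$, the twisted multiple Bernoulli numbers $\mathfrak{B}((n_j);(\xi_j);(\gamma_j))$ are defined by the power series identity $$\prod_{j=1}^r\frac{1}{1-\xi_j\exp\left(\gamma_j\sum_{k=j}^rt_k\right)}=\sum_{n_1=0}^\infty\cdots\sum_{n_r=0}^\infty\mathfrak{B}((n_j);(\xi_j);(\gamma_j))\frac{t_1^{n_1}}{n_1!}\cdots\frac{t_r^{n_r}}{n_r!}.$$ Put $q=4$ if $p=2$ and $q=p$ if $p\geqslant3$. Let $W=\{\pm1\}$ if $p=2$ and $W=\{\xi\in\mathbb{Z}_p^\times\mid\xi^{p-1}=1\}$ if $p\geqslant3$. Every $x\in\mathbb{Z}_p^\times$ is uniquely $x=\omega(x)\langle x\rangle$ with $\omega(x)\in W$, $\langle x\rangle\in1+q\mathbb{Z}_p$. For $z\in\mathbb{C}_p$ with $|z-1|_p\geqslant1$, $\mathfrak{m}_z$ is the measure on $\mathbb{Z}_p$ with $\mathfrak{m}_z(j+p^N\mathbb{Z}_p)=\frac{z^j}{1-z^{p^N}}$ $(0\leqslant j\leqslant p^N-1)$. For $c\in\mathbb{N}_{>1}$ prime to $p$, $\widetilde{\mathfrak{m}}_c=\sum_{\xi^c=1,\,\xi\neq1}\mathfrak{m}_\xi$,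 a $\mathbb{Z}_p$-valued measure. Put $(\mathbb{Z}_p^r)'_{\{\gamma_j\}}=\{(x_j)\in\mathbb{Z}_p^r\mid p\nmid x_1\gamma_1,\ p\nmid(x_1\gamma_1+x_2\gamma_2),\ldots,\ p\nmid\sum_{j=1}^rx_j\gamma_j\}$. For $k_j\in\mathbb{Z}$ and $s_j\in\mathbb{C}_p$ with $|s_j|_p<qp^{-1/(p-1)}$ (in particular $s_j\in\mathbb{Z}_p$) the $p$-adic multiple $L$-function is $$L_{p,r}(s_1,\ldots,s_r;\omega^{k_1},\ldots,\omega^{k_r};\gamma_1,\ldots,\gamma_r;c)=\int_{(\mathbb{Z}_p^r)'_{\{\gamma_j\}}}\prod_{i=1}^r\Bigl\langle\sum_{j=1}^ix_j\gamma_j\Bigr\rangle^{-s_i}\omega^{k_i}\Bigl(\sum_{j=1}^ix_j\gamma_j\Bigr)\prod_{j=1}^rd\widetilde{\mathfrak{m}}_c(x_j)$$ (zero if the domain is empty). *)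

(* Defs.v *)
From HB Require Import structures.
From mathcomp Require Import all_boot all_order all_algebra.
From mathcomp Require Import boolp classical_sets functions fsbigop reals.
From mathcomp Require Import topology normedtype.

Set Implicit Arguments.
Unset Strict Implicit.
Unset Printing Implicit Defensive.

Import Order.TTheory GRing.Theory Num.Theory.
Import numFieldNormedType.Exports.

Local Open Scope classical_set_scope.
Local Open Scope ring_scope.

(* Everything p-adic lives in one field C with an absolute value [abs]: Q_p is
   the closure of Q in C, and Z_p is the closed unit ball of Q_p. *)

Definition cvg_abs (R : realType) (C : fieldType) (abs : C -> R)
    (u : nat -> C) (l : C) : Prop :=
  abs (u n - l) @[n --> \oo] --> (0 : R).

Definition cauchy_abs (R : realType) (C : fieldType) (abs : C -> R)
    (u : nat -> C) : Prop :=
  forall e : R, 0 < e ->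
    exists N, forall m n, (N <= m)%N -> (N <= n)%N -> abs (u m - u n) < e.

Definition padic_num (R : realType) (C : fieldType) (abs : C -> R) : set C :=
  [set x | forall e : R, 0 < e -> exists a : rat, abs (x - ratr a) < e].

Definition padic_int (R : realType) (C : fieldType) (abs : C -> R) : set C :=
  [set x | padic_num abs x /\ abs x <= 1].

Definition padic_algebraic (R : realType) (C : fieldType) (abs : C -> R) :
    set C :=
  [set x | exists P : {poly C},
     [/\ P != 0, forall i, padic_num abs P`_i & root P x]].

(* (C, abs) is the completion of an algebraic closure of Q_p, normalised by
   |p| = 1/p.  Completeness makes the closure of Q in C the completion of Q;
   the remaining two conditions say that the elements of C algebraic over Q_p
   form an algebraically closed field, dense in C. *)
Record is_Cp (R : realType) (p : nat) (C : fieldType) (abs : C -> R) : Prop :=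
  IsCp {
    abs_ge0 : forall x, 0 <= abs x;
    abs_eq0 : forall x, abs x = 0 <-> x = 0;
    absM : forall x y, abs (x * y) = abs x * abs y;
    abs_ultrametric : forall x y, abs (x + y) <= Num.max (abs x) (abs y);
    abs_prime : abs p%:R = p%:R^-1;
    abs_complete : forall u, cauchy_abs abs u -> exists l, cvg_abs abs u l;
    algebraic_closed : forall P : {poly C},
      (1 < size P)%N -> (forall i, padic_algebraic abs P`_i) ->
      exists x, root P x;
    algebraic_dense : forall (x : C) (e : R), 0 < e ->
      exists2 y, padic_algebraic abs y & abs (x - y) < e }.

(* Total limit, 0 if [u] diverges. *)
Definition lim_abs (R : realType) (C : fieldType) (abs : C -> R)
    (u : nat -> C) : C :=
  xget 0 [set l | cvg_abs abs u l].

Definition padic_unit (R : realType) (C : fieldType) (abs : C -> R) : set C :=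
  [set x | [/\ padic_int abs x, x != 0 & padic_int abs x^-1]].

Definition padic_multiple (R : realType) (C : fieldType) (abs : C -> R)
    (m : nat) : set C :=
  [set x | exists2 y, padic_int abs y & x = m%:R * y].

(* rho ^ gamma for rho ^ p = 1 and gamma in Z_p. *)
Definition root_pow (R : realType) (p : nat) (C : fieldType) (abs : C -> R)
    (rho gamma : C) : C :=
  rho ^ (xget (0 : int) [set a | padic_multiple abs p (gamma - a%:~R)]).

(** Formal power series in t_0, ..., t_(r-1), as coefficient functions *)

Definition mseries (r : nat) (C : fieldType) : Type := ('I_r -> nat) -> C.

Definition mser_one (r : nat) (C : fieldType) : mseries r C :=
  fun n => ([forall j, n j == 0%N])%:R.

Definition mser_var (r : nat) (C : fieldType) (k : 'I_r) : mseries r C :=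
  fun n => ([forall j, n j == (j == k)])%:R.

Definition mser_mul (r : nat) (C : fieldType) (f g : mseries r C) :
    mseries r C :=
  fun n => \sum_(a : {dffun forall j : 'I_r, 'I_(n j).+1})
    f (fun j => a j) * g (fun j => (n j - a j)%N).

Definition mser_pow (r : nat) (C : fieldType) (f : mseries r C) (m : nat) :
    mseries r C :=
  iter m (mser_mul f) (@mser_one r C).

Definition mser_inv (r : nat) (C : fieldType) (f : mseries r C) :
    mseries r C :=
  xget (fun=> 0) [set g | mser_mul f g = @mser_one r C].

(* Only for f without constant term: then f ^ m contributes to the coefficient
   of t ^ n only for m at most the total degree of n. *)
Definition mser_exp (r : nat) (C : fieldType) (f : mseries r C) :
    mseries r C :=
  fun n => \sum_(m < (\sum_j n j).+1) mser_pow f m n / (m`!)%:R.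

Definition bernoulli_factor (r : nat) (C : fieldType) (xi gamma : C)
    (j : 'I_r) : mseries r C :=
  mser_inv (fun n => mser_one C n
    - xi * mser_exp (fun m => gamma * \sum_(k < r | (j <= k)%N) mser_var C k m)
             n).

Definition twisted_bernoulli (r : nat) (C : fieldType)
    (n : 'I_r -> nat) (xi gamma : 'I_r -> C) : C :=
  (\prod_(j < r) (n j)`!)%:R *
  (\big[@mser_mul r C/@mser_one r C]_(j < r)
     bernoulli_factor (xi j) (gamma j) j) n.

Definition nontrivial_roots (C : fieldType) (c : nat) : set C :=
  [set z | z ^+ c = 1 /\ z != 1].

Definition nontrivial_root_tuples (C : fieldType) (r c : nat) :
    set {ffun 'I_r -> C} :=
  [set xi | forall j, nontrivial_roots c (xi j)].

(** p-adic measures and integration *)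

(* A measure mu on Z_p is given by its values mu N j on j + p^N Z_p, where
   0 <= j < p^N. *)
Definition koblitz_measure (p : nat) (C : fieldType) (z : C) (N j : nat) : C :=
  z ^+ j / (1 - z ^+ (p ^ N)).

Definition koblitz_measure_sum (p : nat) (C : fieldType) (c : nat)
    (N j : nat) : C :=
  \sum_(xi \in nontrivial_roots c) koblitz_measure p xi N j.

(* Integral over D, compact open in Z_p^r, against the r-fold product of mu:
   the limit of the Riemann sums attached to the partitions of Z_p^r into
   products of balls of radius p^-N. *)
Definition padic_integral (R : realType) (p : nat) (C : fieldType)
    (abs : C -> R) (r : nat) (mu : nat -> nat -> C)
    (D : set ('I_r -> C)) (f : ('I_r -> C) -> C) : C :=
  lim_abs abs (fun N =>
    \sum_(x : {ffun 'I_r -> 'I_(p ^ N)} | `[< D (fun j => (x j)%:R) >])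
      f (fun j => (x j)%:R) * \prod_(j < r) mu N (x j)).

(** The p-adic multiple L-function *)

Definition padic_q (p : nat) : nat := if p == 2%N then 4%N else p.

Definition padic_W (R : realType) (p : nat) (C : fieldType) (abs : C -> R) :
    set C :=
  if p == 2%N then [set 1; -1]
  else [set w | padic_unit abs w /\ w ^+ p.-1 = 1].

Definition teichmuller (R : realType) (p : nat) (C : fieldType)
    (abs : C -> R) (x : C) : C :=
  xget 1 [set w | padic_W p abs w /\
    exists2 u, padic_multiple abs (padic_q p) (u - 1) & x = w * u].

Definition angle (R : realType) (p : nat) (C : fieldType) (abs : C -> R)
    (x : C) : C :=
  x / teichmuller p abs x.

Definition padic_log (R : realType) (C : fieldType) (abs : C -> R) (x : C) :
    C :=
  lim_abs abs (fun N =>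
    \sum_(1 <= k < N) (-1) ^+ k.-1 * (x - 1) ^+ k / k%:R).

Definition padic_exp (R : realType) (C : fieldType) (abs : C -> R) (x : C) :
    C :=
  lim_abs abs (fun N => \sum_(0 <= k < N) x ^+ k / (k`!)%:R).

(* x ^ s for x in 1 + q Z_p; both series converge when |s| < q p^(-1/(p-1)). *)
Definition padic_pow (R : realType) (C : fieldType) (abs : C -> R) (x s : C) :
    C :=
  padic_exp abs (s * padic_log abs x).

Definition partial_dot (r : nat) (C : fieldType) (gamma x : 'I_r -> C)
    (i : 'I_r) : C :=
  \sum_(j < r | (j <= i)%N) x j * gamma j.

Definition padicL_domain (R : realType) (p : nat) (C : fieldType)
    (abs : C -> R) (r : nat) (gamma : 'I_r -> C) : set ('I_r -> C) :=
  [set x | (forall j, padic_int abs (x j)) /\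
           forall i, ~ padic_multiple abs p (partial_dot gamma x i)].

Definition padicL (R : realType) (p : nat) (C : fieldType) (abs : C -> R)
    (r : nat) (s : 'I_r -> C) (k : 'I_r -> int) (gamma : 'I_r -> C)
    (c : nat) : C :=
  padic_integral p abs (@koblitz_measure_sum p C c)
    (padicL_domain p abs gamma)
    (fun x => \prod_(i < r)
       (padic_pow abs (angle p abs (partial_dot gamma x i)) (- s i) *
        teichmuller p abs (partial_dot gamma x i) ^ k i)).

(* Main.v *)
(* For rho^p = 1, the average of rho^y over rho is the indicator of p | y, so the
   indicator of the domain of integration is a product of factors
   1 - (1/p) sum_rho rho^y_i, where y_i = x_1 gamma_1 + ... + x_i gamma_i; expanding
   the product gives the sum over i_1 < ... < i_d.  On the domain
   <y>^n omega(y)^n = y^n, since exp (n log <y>) = <y>^n.  The Riemann sum of level N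
   is thereby reduced to sums over 0 <= x_j < p^N of
   prod_i y_i^n_i prod_j eta_j^x_j / (1 - eta_j^(p^N)).
   Up to factorials, such a sum is the coefficient of t^n in
   prod_j (1 - eta_j^P exp (P T_j)) / ((1 - eta_j^P) (1 - eta_j exp T_j)), where
   P = p^N and T_j = gamma_j (t_j + ... + t_r).
   As |1 - eta_j^P| = 1 and P tends to 0, this coefficient tends to the one of
   prod_j 1 / (1 - eta_j exp T_j). *)
From HB Require Import structures.
Require Import Defs.
From mathcomp Require Import all_boot all_order all_algebra zify ring lra.
From mathcomp Require Import boolp classical_sets functions fsbigop reals.
From mathcomp Require Import topology normedtype sequences.

Set Implicit Arguments.
Unset Strict Implicit.
Unset Printing Implicit Defensive.

Import Order.TTheory GRing.Theory Num.Theory.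
Import numFieldNormedType.Exports.

Local Open Scope ring_scope.

(** * Multivariate formal power series *)

(** Two points need more than manipulation of series. In general the powers eta_j^P do not converge.
    With E = exp (P T_j), each factor is therefore written (1 - eta_j^P E) / (1 - eta_j^P) = 1 +
    eta_j^P / (1 - eta_j^P) (1 - E), where a bounded quantity multiplies one that tends to 0. The
    bound |1 - eta_j^P| = 1 holds because eta_j = theta_j xi_j with theta_j^p = 1 and xi_j^c = 1: a
    further p-th power removes theta_j, and 1 - xi divides the p-adic unit c for every nontrivial
    c-th root xi. The identity exp (n log u) = u^n involves two nested limits. It is deduced from an
    identity between truncated polynomials, with errors controlled by |1/k!| <= 2^(k-1), valid for
    every p. This asks for |u - 1| < 1/2, which q guarantees: |q| is 1/4 for p = 2 and at most 1/3
    otherwise. The measure has xi_j^P in its denominator where the moments have eta_j^P; the two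
    agree from N = 1 on, so level 0 is dropped. *)

Section MultiSeries.
Variables (r : nat) (C : fieldType).
Implicit Types (f g h : mseries r C) (n : 'I_r -> nat) (b : 'I_r -> C).

(** The index type of [mser_mul] depends on [n]. Placing all multi-indices among the functions to
    one ['I_M] lets sums attached to different [n] be exchanged. *)
Lemma mser_mul_le f g n M : (forall j, (n j < M)%N) ->
  mser_mul f g n =
  \sum_(a : {ffun 'I_r -> 'I_M} | a \in family (fun j => [pred i : 'I_M | (i <= n j)%N]))
    f (fun j => a j) * g (fun j => (n j - a j)%N).
Proof.
move=> nM; rewrite /mser_mul.
pose h (a : {dffun forall j : 'I_r, 'I_(n j).+1}) : {ffun 'I_r -> 'I_M} :=
  [ffun j => widen_ord (nM j) (a j)].
pose h' (a : {ffun 'I_r -> 'I_M}) : {dffun forall j : 'I_r, 'I_(n j).+1} :=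
  [ffun j => inord (a j)].
rewrite (reindex_onto h h') /=; last first.
  move=> a /familyP aP; apply/ffunP => j; rewrite !ffunE; apply: val_inj => /=.
  by rewrite inordK // ltnS; apply: aP.
rewrite [RHS](eq_bigl xpredT) => [|a].
  by apply: eq_bigr => a _; congr (f _ * g _); apply/funext => j; rewrite ffunE.
apply/andP; split.
  by apply/familyP => j; rewrite ffunE inE /= -ltnS.
by apply/eqP/ffunP => j; rewrite !ffunE; apply: val_inj; rewrite /= inordK.
Qed.

(** Pairs make the two factors symmetric, so that commutativity is an exchange of sums. *)
Lemma mser_mul_pairs f g n M : (forall j, (n j < M)%N) ->
  mser_mul f g n =
  \sum_(a : {ffun 'I_r -> 'I_M}) \sum_(a' : {ffun 'I_r -> 'I_M} |
      [forall j, a j + a' j == n j]%N) f (fun j => a j) * g (fun j => a' j).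
Proof.
move=> nM; rewrite (mser_mul_le _ _ nM) big_mkcond /=; apply: eq_bigr => a _.
case: ifPn => [/familyP aP|aP].
  pose a' : {ffun 'I_r -> 'I_M} :=
    [ffun j => Ordinal (leq_ltn_trans (leq_subr (a j) (n j)) (nM j))].
  rewrite (big_pred1 a') => [|u]; last first.
    apply/forallP/eqP => [H|-> j]; last first.
      by rewrite ffunE /= subnKC //; apply: aP.
    apply/ffunP => j; apply: val_inj; rewrite ffunE /=.
    by rewrite -(eqP (H j)) addKn.
  by congr (_ * g _); apply/funext => j; rewrite ffunE.
rewrite big_pred0 // => a'; apply/negP => /forallP H; case/negP: aP.
by apply/familyP => j; rewrite inE -(eqP (H j)) leq_addr.
Qed.

Lemma mser_bound n : exists M, forall j, (n j < M.+1)%N.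
Proof. by exists (\max_j n j)%N => j; rewrite ltnS (leq_bigmax j). Qed.

Lemma mser_mulC : commutative (@mser_mul r C).
Proof.
move=> f g; apply/funext => n; have [M nM] := mser_bound n.
rewrite !(mser_mul_pairs _ _ nM) (exchange_big_dep xpredT) //=.
apply: eq_bigr => a _; apply: eq_big => [a'|a' _]; last exact: mulrC.
by apply: eq_forallb => j; rewrite addnC.
Qed.

Let triple f g h n M : C :=
  \sum_(a : {ffun 'I_r -> 'I_M}) \sum_(a' : {ffun 'I_r -> 'I_M})
  \sum_(a'' : {ffun 'I_r -> 'I_M} | [forall j, a j + a' j + a'' j == n j]%N)
   f (fun j => a j) * g (fun j => a' j) * h (fun j => a'' j).

Let mser_mul_triple f g h n M : (forall j, (n j < M)%N) ->
  mser_mul (mser_mul f g) h n = triple f g h n M.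
Proof.
move=> nM; rewrite (mser_mul_pairs _ _ nM).
transitivity (\sum_(a'' : {ffun 'I_r -> 'I_M})
   \sum_(u : {ffun 'I_r -> 'I_M} | [forall j, u j + a'' j == n j]%N)
   \sum_(a : {ffun 'I_r -> 'I_M}) \sum_(a' : {ffun 'I_r -> 'I_M} |
      [forall j, a j + a' j == u j]%N) f (fun j => a j) * g (fun j => a' j) * h (fun j => a'' j)).
  rewrite (exchange_big_dep xpredT) //=; apply: eq_bigr => a'' _.
  apply: eq_bigr => u _; rewrite (@mser_mul_pairs _ _ _ M) //.
  by rewrite mulr_suml; apply: eq_bigr => a _; rewrite mulr_suml.
rewrite /triple; under [RHS]eq_bigr do rewrite (exchange_big_dep xpredT) //=.
rewrite [RHS]exchange_big /=; apply: eq_bigr => a'' _.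
rewrite exchange_big /=; apply: eq_bigr => a _.
rewrite (exchange_big_dep xpredT) //= [RHS]big_mkcond /=; apply: eq_bigr => a' _.
case: ifPn => [/forallP H|H].
  have aM j : (a j + a' j < M)%N.
    by apply: leq_ltn_trans (nM j); rewrite -(eqP (H j)) leq_addr.
  rewrite (big_pred1 [ffun j => Ordinal (aM j)]) // => u.
  apply/andP/eqP => [[_ /forallP E]|->].
    by apply/ffunP => j; apply: val_inj; rewrite ffunE /= (eqP (E j)).
  by split; apply/forallP => j; rewrite ffunE //=; apply: H.
rewrite big_pred0 // => u; apply/negP => /andP[/forallP E /forallP F].
by case/negP: H; apply/forallP => j; rewrite (eqP (F j)).
Qed.

Lemma mser_mulA : associative (@mser_mul r C).
Proof.
move=> f g h; apply/funext => n; have [M nM] := mser_bound n.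
(* By commutativity f (g h) is (g h) f, so one triple-sum formula covers both bracketings. *)
rewrite [mser_mul f _]mser_mulC !(mser_mul_triple _ _ _ nM) /triple.
under eq_bigr => a _ do under eq_bigr => a' _ do rewrite big_mkcond /=.
under [RHS]eq_bigr => a _ do under eq_bigr => a' _ do rewrite big_mkcond /=.
under eq_bigr => a _ do rewrite exchange_big /=.
rewrite exchange_big /=; apply: eq_bigr => a _; apply: eq_bigr => a' _.
apply: eq_bigr => a'' _; rewrite (@eq_forallb _ _ (fun j => a j + a' j + a'' j == n j)%N).
  by case: ifP => // _; ring.
by move=> j; congr (_ == _); ring.
Qed.

Lemma mser_mul1 : left_id (@mser_one r C) (@mser_mul r C).
Proof.
move=> f; apply/funext => n; have [M nM] := mser_bound n.
rewrite (mser_mul_le _ _ nM) (bigD1 [ffun=> ord0]) /=; last first.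
  by apply/familyP => j; rewrite ffunE inE.
rewrite big1 ?addr0 => [|a /andP[_ a0]].
  rewrite /mser_one (_ : [forall j, _]) ?mul1r; last by apply/forallP => j; rewrite ffunE.
  by congr (f _); apply/funext => j; rewrite ffunE subn0.
rewrite /mser_one; case: forallP; rewrite ?mul0r // => H.
by case/eqP: a0; apply/ffunP => j; apply: val_inj; rewrite ffunE /=; apply/eqP/H.
Qed.

Lemma mser_mulDl : left_distributive (@mser_mul r C) (fun f g => (fun n => f n + g n)).
Proof.
move=> f g h; apply/funext => n; rewrite /mser_mul -big_split /=.
by apply: eq_bigr => a _; rewrite mulrDl.
Qed.

End MultiSeries.

(** * The ring of power series, exponentials of linear forms, inverses *)

HB.instance Definition _ r C := gen_eqMixin (mseries r C).
HB.instance Definition _ r C := gen_choiceMixin (mseries r C).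

Section MultiSeriesRing.
Variables (r : nat) (C : fieldType).
Implicit Types (f g h : mseries r C) (n : 'I_r -> nat) (b : 'I_r -> C).

Definition mser_add f g : mseries r C := fun n => f n + g n.
Definition mser_opp f : mseries r C := fun n => - f n.
Definition mser_zero : mseries r C := fun=> 0.

Let addA : associative mser_add.
Proof. by move=> f g h; apply/funext => n; apply: addrA. Qed.
Let addC : commutative mser_add.
Proof. by move=> f g; apply/funext => n; apply: addrC. Qed.
Let add0 : left_id mser_zero mser_add.
Proof. by move=> f; apply/funext => n; apply: add0r. Qed.
Let addN : left_inverse mser_zero mser_opp mser_add.
Proof. by move=> f; apply/funext => n; apply: addNr. Qed.

HB.instance Definition _ := GRing.isZmodule.Build (mseries r C) addA addC add0 addN.

HB.instance Definition _ := GRing.Zmodule_isComPzRing.Build (mseries r C)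
  (@mser_mulA r C) (@mser_mulC r C) (@mser_mul1 r C) (@mser_mulDl r C).

Lemma mser_addE f g n : (f + g) n = f n + g n. Proof. by []. Qed.
Lemma mser_oppE f n : (- f) n = - f n. Proof. by []. Qed.
Lemma mser_mulE f g : f * g = mser_mul f g. Proof. by []. Qed.
Lemma mser_oneE : 1 = mser_one C :> mseries r C. Proof. by []. Qed.
Lemma mser_one0 : mser_one C (fun _ : 'I_r => 0%N) = 1.
Proof. by rewrite /mser_one (_ : [forall j, _]) //; apply/forallP. Qed.
Lemma mser_powE f m : mser_pow f m = f ^+ m.
Proof. by elim: m => // m IH; rewrite exprS -IH. Qed.
Lemma mser_sumE I (s : seq I) (P : pred I) (F : I -> mseries r C) n :
  (\sum_(i <- s | P i) F i) n = \sum_(i <- s | P i) F i n.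
Proof. by elim/big_rec2: _ => // i x y _ <-. Qed.

Definition mser_const (a : C) : mseries r C := fun n => a * mser_one C n.

Lemma mser_constM a f n : (mser_const a * f) n = a * f n.
Proof.
rewrite -[f in RHS](mul1r f) !mser_mulE /mser_mul mulr_sumr.
by apply: eq_bigr => u _; rewrite mulrA.
Qed.

Lemma mser_const1 : mser_const 1 = 1.
Proof. by apply/funext => n; apply: mul1r. Qed.

Lemma mser_const_mul a a' : mser_const (a * a') = mser_const a * mser_const a'.
Proof. by apply/funext => n; rewrite mser_constM /mser_const mulrA. Qed.

Lemma mser_constX a m : mser_const (a ^+ m) = mser_const a ^+ m.
Proof.
by elim: m => [|m IH]; rewrite ?mser_const1 // !exprS mser_const_mul IH.
Qed.

Lemma mser_const_prod (a : 'I_r -> C) : mser_const (\prod_j a j) = \prod_j mser_const (a j).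
Proof.
elim/big_rec2: _ => [|j x y _ <-]; first exact: mser_const1.
exact: mser_const_mul.
Qed.

(* exp (\sum_k b_k t_k) *)
Definition mser_explin b : mseries r C :=
  fun n => \prod_k (b k ^+ n k / (n k)`!%:R).

Hypothesis charC : forall m : nat, m.+1%:R != 0 :> C.

Let fact_neq0 m : (m`!)%:R != 0 :> C.
Proof. by case: m`! (fact_gt0 m). Qed.

(** The sum over multi-indices below [n] factors over the variables, leaving the binomial theorem
    for each exponent [n k]. *)
Lemma mser_explinD b b' : mser_explin (fun k => b k + b' k) = mser_explin b * mser_explin b'.
Proof.
apply/funext => n; rewrite mser_mulE; have [M nM] := mser_bound n.
rewrite (mser_mul_le _ _ nM) /mser_explin.
under [RHS]eq_bigr do rewrite -big_split /=.
rewrite -(bigA_distr_big_dep (fun k => [pred i : 'I_M.+1 | (i <= n k)%N])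
  (fun k (i : 'I_M.+1) => b k ^+ i / i`!%:R * (b' k ^+ (n k - i) / (n k - i)`!%:R))) /=.
apply: eq_bigr => k _; rewrite addrC exprDn.
rewrite [RHS](eq_bigl (fun i : 'I_M.+1 => i < (n k).+1)%N) //.
rewrite -(big_ord_widen _
  (fun i => b k ^+ i / i`!%:R * (b' k ^+ (n k - i) / (n k - i)`!%:R)) (nM k)).
rewrite mulr_suml; apply: eq_bigr => i _.
have := bin_fact (ltn_ord i : i <= n k)%N => /(congr1 (fun m : nat => m%:R : C)).
rewrite !natrM => <-; rewrite -mulr_natr.
have bin_neq0 : ('C(n k, i))%:R != 0 :> C.
  by rewrite -(prednK (_ : 0 < 'C(n k, i))%N) // bin_gt0 -ltnS.
field; by rewrite !fact_neq0 bin_neq0.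
Qed.

Lemma mser_explin0 : mser_explin (fun=> 0) = 1.
Proof.
apply/funext => n; rewrite mser_oneE /mser_one /mser_explin.
case: forallP => [H|/forallP/forallPn[j nj]].
  by rewrite big1 // => j _; rewrite (eqP (H j)) expr0 divr1.
by rewrite (bigD1 j) //= expr0n (negPf nj) !mul0r.
Qed.

Lemma mser_explinX b m : mser_explin b ^+ m = mser_explin (fun k => m%:R * b k).
Proof.
elim: m => [|m IH].
  by rewrite expr0 -mser_explin0; congr mser_explin; apply/funext => k; rewrite mul0r.
rewrite exprS IH -mser_explinD; congr mser_explin; apply/funext => k.
by rewrite -natr1 mulrDl mul1r addrC.
Qed.

Lemma mser_explin_prod (I : finType) (F : I -> 'I_r -> C) :
  \prod_i mser_explin (F i) = mser_explin (fun k => \sum_i F i k).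
Proof.
elim: (index_enum I) => [|i s IH].
  by rewrite big_nil -mser_explin0; congr mser_explin; apply/funext => k; rewrite big_nil.
rewrite big_cons IH -mser_explinD; congr mser_explin; apply/funext => k.
by rewrite big_cons.
Qed.

Definition mdeg n := (\sum_j n j)%N.

Lemma mser_varM k f n : (mser_var C k * f) n =
  (0 < n k)%N%:R * f (fun j => n j - (j == k))%N.
Proof.
rewrite mser_mulE; have [M nM] := mser_bound n.
have nM' j : (n j < M.+2)%N by rewrite ltnW // ltnS.
rewrite (mser_mul_le _ _ nM').
pose e : {ffun 'I_r -> 'I_M.+2} := [ffun j => if j == k then lift ord0 ord0 else ord0].
have ee j : e j = (j == k) :> nat by rewrite ffunE; case: eqP.
have varE (a : {ffun 'I_r -> 'I_M.+2}) : mser_var C k (fun j => a j) = (a == e)%:R.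
  rewrite /mser_var; congr (nat_of_bool _)%:R; apply/forallP/eqP => [H|-> j].
    by apply/ffunP => j; apply: val_inj; rewrite /= ee; apply/eqP/H.
  by rewrite ee.
have [nk|nk] := posnP (n k).
  rewrite mul0r big1 // => a /familyP/(_ k); rewrite varE.
  case: eqP => [->|_ _]; last by rewrite mul0r.
  by rewrite inE ee eqxx nk.
rewrite (bigD1 e) /=; last first.
  by apply/familyP => j; rewrite inE ee; case: eqP => // ->.
rewrite big1 ?addr0 => [|a /andP[_ /negPf ae]]; last by rewrite varE ae mul0r.
by rewrite varE eqxx; congr (_ * f _); apply/funext => j; rewrite ee.
Qed.

(** The multinomial theorem, by induction on the exponent. *)
Lemma linear_formX b m n : ((\sum_k mser_const (b k) * mser_var C k) ^+ m) n =
  (mdeg n == m)%:R * (m`!)%:R * mser_explin b n.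
Proof.
elim: m n => [|m IH] n.
  have -> : (mdeg n == 0)%N = [forall j, n j == 0%N].
    by rewrite /mdeg sum_nat_eq0; apply: eq_forallb.
  rewrite expr0 mser_oneE /mser_one.
  case: forallP => [H|]; last by rewrite !mul0r.
  by rewrite mulr1 mul1r /mser_explin big1 // => j _; rewrite (eqP (H j)) expr0 divr1.
rewrite exprS mulr_suml mser_sumE.
(* Multiplication by b_k t_k lowers the k-th exponent and contributes n_k times a quantity common to
   all k; the n_k add up to the degree m + 1, which turns m! into (m + 1)!. *)
transitivity (\sum_k (n k)%:R * ((mdeg n == m.+1)%:R * (m`!)%:R * mser_explin b n)).
  apply: eq_bigr => k _; rewrite -mulrA mser_constM mser_varM IH.
  have [nk|nk] := posnP (n k); first by rewrite nk !(mul0r, mulr0).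
  have -> : (mdeg (fun j => n j - (j == k)) == m)%N = (mdeg n == m.+1).
    rewrite /mdeg (bigD1 k) //= [in RHS](bigD1 k) //= eqxx.
    rewrite (eq_bigr n) => [|j /negPf->]; last by rewrite subn0.
    by rewrite -{2}(prednK nk) addSn eqSS subn1.
  rewrite mul1r /mser_explin (bigD1 k) //= [in RHS](bigD1 k) //= eqxx.
  rewrite (eq_bigr (fun j => b j ^+ n j / (n j)`!%:R)) => [|j /negPf->]; last by rewrite subn0.
  rewrite -{3 4 5}(prednK nk) subn1 factS natrM exprS.
  have aux (x y z u v w : C) : u != 0 -> v != 0 ->
      z * (y * (x / u * w)) = v * (y * (z * x / (v * u) * w)).
    by move=> u0 v0; field; rewrite u0 v0.
  exact: aux.
rewrite -mulr_suml -natr_sum -/(mdeg n).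
case: eqP => [->|]; last by rewrite !(mul0r, mulr0).
by rewrite factS natrM; ring.
Qed.

(** By homogeneity only the power m = [mdeg n], the last one kept by [mser_exp], reaches the
    coefficient at [n], and its m! cancels the denominator. *)
Lemma mser_exp_linear_form b :
  mser_exp (fun n => \sum_k b k * mser_var C k n) = mser_explin b.
Proof.
have -> : (fun n => \sum_k b k * mser_var C k n) =
    \sum_k mser_const (b k) * mser_var C k.
  by apply/funext => n; rewrite mser_sumE; apply: eq_bigr => k _; rewrite mser_constM.
apply/funext => n; rewrite /mser_exp -/(mdeg n).
rewrite (bigD1 ord_max) //= mser_powE linear_formX eqxx big1 ?addr0 => [|m mn].
  by rewrite mul1r mulrAC divff ?mul1r.
rewrite mser_powE linear_formX; case: eqP => [E|]; last by rewrite !mul0r.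
by case/eqP: mn; apply: val_inj; rewrite /= -E.
Qed.

Lemma mser_expr_low_deg f : f (fun=> 0%N) = 0 ->
  forall m n, (mdeg n < m)%N -> (f ^+ m) n = 0.
Proof.
move=> f0; elim=> // m IH n nm; rewrite exprS mser_mulE /mser_mul big1 // => a _.
have [a0|a0] := eqVneq (mdeg (fun j => a j)) 0%N.
  rewrite (_ : (fun j => _) = fun=> 0%N) ?f0 ?mul0r //; apply/funext => j; apply/eqP.
  by move/eqP: a0; rewrite /mdeg sum_nat_eq0 => /forallP/(_ j).
rewrite IH ?mulr0 // -ltnS; apply: leq_trans nm; rewrite ltnS.
have -> : mdeg n = (mdeg (fun j => a j) + mdeg (fun j => n j - a j))%N.
  by rewrite /mdeg -big_split; apply: eq_bigr => j _ /=; rewrite subnKC // -ltnS.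
by rewrite -[X in (X < _)%N]add0n ltn_add2r lt0n.
Qed.

(** The inverse is the geometric series in f, cut at the degree of the coefficient asked for. At a
    fixed [n] one truncation serves all coefficients involved, and telescoping leaves f^([mdeg n] +
    1), which has no term at [n]. *)
Lemma mser_geometric f : f (fun=> 0%N) = 0 -> exists g, (1 - f) * g = 1.
Proof.
move=> f0; pose g : mseries r C := fun n => (\sum_(i < (mdeg n).+1) f ^+ i) n.
exists g; apply/funext => n.
have gE m : (mdeg m <= mdeg n)%N -> g m = (\sum_(i < (mdeg n).+1) f ^+ i) m.
  move=> mn; rewrite /g !mser_sumE.
  rewrite (big_ord_widen _ (fun i => (f ^+ i) m) (_ : _ <= (mdeg n).+1)%N) //.
  rewrite [RHS](bigID (fun i : 'I_(mdeg n).+1 => (i < (mdeg m).+1)%N)) /=.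
  rewrite [X in _ = _ + X]big1 ?addr0 // => i; rewrite -leqNgt => im.
  exact: mser_expr_low_deg.
have -> : ((1 - f) * g) n = ((1 - f) * \sum_(i < (mdeg n).+1) f ^+ i) n.
  rewrite !mser_mulE; apply: eq_bigr => a _; congr (_ * _); apply: gE.
  by apply: leq_sum => j _; apply: leq_subr.
rewrite -[1 - f]opprB mulNr -subrX1 opprB mser_addE mser_oppE mser_expr_low_deg //.
by rewrite subr0.
Qed.

Lemma mser_invP f : f (fun=> 0%N) != 0 -> f * mser_inv f = 1.
Proof.
move=> f0; rewrite /mser_inv; case: xgetP => // /(_ _) H.
(* Dividing by the constant term brings f to the form 1 - h with h free of constant term. *)
have [|g fg] := @mser_geometric (1 - mser_const (f (fun=> 0%N))^-1 * f).
  by rewrite mser_addE mser_oppE mser_constM mser_oneE mser_one0 mulVf ?subrr.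
case: (H (mser_const (f (fun=> 0%N))^-1 * g)).
by rewrite /= -mser_mulE -mser_oneE -fg; ring.
Qed.

(* The exponent of the j-th factor: gamma * (t_j + ... + t_(r-1)). *)
Definition tail_form (a : C) (j : 'I_r) : 'I_r -> C := fun k => a * (j <= k)%N%:R.

Lemma bernoulli_factorP eta a j : eta != 1 ->
  (1 - mser_const eta * mser_explin (tail_form a j)) * bernoulli_factor eta a j = 1.
Proof.
move=> eta1; rewrite /bernoulli_factor.
set f := (fun n : 'I_r -> nat => _).
have -> : 1 - mser_const eta * mser_explin (tail_form a j) = f.
  apply/funext => n; rewrite mser_addE mser_oppE mser_constM /f.
  rewrite -mser_exp_linear_form; congr (_ - _ * mser_exp _ _); apply/funext => m.
  rewrite mulr_sumr [RHS]big_mkcond /=; apply: eq_bigr => k _; rewrite /tail_form.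
  by case: leqP; rewrite ?mulr1 // mulr0 mul0r.
apply: mser_invP; rewrite /f mser_one0.
set e := mser_exp _ _; have -> : e = 1; last by rewrite mulr1 subr_eq0 eq_sym.
rewrite /e /mser_exp [(\sum_j 0)%N]big1 // big_ord_recl big_ord0 addr0.
by rewrite /mser_pow /= mser_one0 divr1.
Qed.

(** With E = eta exp T this is the finite geometric sum (1 - E^P) / (1 - E), where E^x = eta^x exp
    (x T). *)
Lemma bernoulli_factor_geometric eta a j P : eta != 1 ->
  \sum_(x < P) mser_const (eta ^+ x) * mser_explin (tail_form (x%:R * a) j) =
  (1 - mser_const (eta ^+ P) * mser_explin (tail_form (P%:R * a) j)) *
  bernoulli_factor eta a j.
Proof.
move=> eta1; pose E := mser_const eta * mser_explin (tail_form a j).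
have EX x : mser_const (eta ^+ x) * mser_explin (tail_form (x%:R * a) j) = E ^+ x.
  rewrite /E exprMn -mser_constX mser_explinX; congr (_ * mser_explin _).
  by apply/funext => k; rewrite /tail_form mulrA.
under eq_bigr do rewrite EX.
rewrite EX -[1 - _]opprB subrX1 -mulNr opprB mulrAC bernoulli_factorP ?mul1r //.
Qed.

End MultiSeriesRing.

(** * The absolute value, limits and p-adic integers *)

Section PadicAbs.
Variables (R : realType) (p : nat) (C : fieldType) (abs : C -> R).
Hypotheses (p_prime : prime p) (absP : is_Cp p abs).

Lemma abs0 : abs 0 = 0. Proof. exact/(abs_eq0 absP). Qed.

Lemma abs_gt0 x : x != 0 -> 0 < abs x.
Proof.
by move=> x0; rewrite lt_def (abs_ge0 absP) andbT; apply/contra_neq: x0 => /(abs_eq0 absP).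
Qed.

Lemma abs1 : abs 1 = 1.
Proof.
have := absM absP 1 1; rewrite mulr1 -[LHS]mulr1 => /mulfI -> //.
by rewrite gt_eqF // abs_gt0 ?oner_eq0.
Qed.

Lemma absX x m : abs (x ^+ m) = abs x ^+ m.
Proof. by elim: m => [|m IH]; rewrite ?abs1 // !exprS (absM absP) IH. Qed.

Lemma abs_root1 x m : (0 < m)%N -> x ^+ m = 1 -> abs x = 1.
Proof.
move=> m0 /(congr1 abs)/eqP; rewrite absX abs1 pexpr_eq1 // ?(abs_ge0 absP) //.
by move/eqP.
Qed.

Lemma absN x : abs (- x) = abs x.
Proof.
by rewrite -mulN1r (absM absP) (@abs_root1 _ 2) ?mul1r // sqrrN expr1n.
Qed.

Lemma absB x y : abs (x - y) = abs (y - x).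
Proof. by rewrite -absN opprB. Qed.

Lemma absV x : abs x^-1 = (abs x)^-1.
Proof.
have [->|x0] := eqVneq x 0; first by rewrite invr0 abs0 invr0.
have /lt0r_neq0 a0 := abs_gt0 x0; apply: (mulfI a0).
by rewrite -(absM absP) !divff ?abs1.
Qed.

Lemma abs_addr_le e x y : abs x <= e -> abs y <= e -> abs (x + y) <= e.
Proof. by move=> xe ye; apply: le_trans (abs_ultrametric absP x y) _; rewrite ge_max xe. Qed.

Lemma abs_subr_le e x y : abs x <= e -> abs y <= e -> abs (x - y) <= e.
Proof. by move=> xe ye; apply: abs_addr_le; rewrite ?absN. Qed.

Lemma abs_addr_lt e x y : abs x < e -> abs y < e -> abs (x + y) < e.
Proof. by move=> xe ye; apply: le_lt_trans (abs_ultrametric absP x y) _; rewrite gt_max xe. Qed.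

Lemma abs_sum_le (I : Type) (s : seq I) (P : pred I) (F : I -> C) e :
  0 <= e -> (forall i, P i -> abs (F i) <= e) -> abs (\sum_(i <- s | P i) F i) <= e.
Proof.
by move=> e0 H; elim/big_rec: _ => [|i x Pi]; rewrite ?abs0 //; apply: abs_addr_le (H i Pi).
Qed.

Lemma abs_nat_le1 m : abs m%:R <= 1.
Proof.
by elim: m => [|m IH]; rewrite ?abs0 ?ler01 // -natr1; apply: abs_addr_le; rewrite ?abs1.
Qed.

Lemma p_gt0 : 0 < p%:R :> R. Proof. by rewrite ltr0n prime_gt0. Qed.

Lemma invp_gt0 : 0 < p%:R^-1 :> R. Proof. by rewrite invr_gt0 p_gt0. Qed.

Lemma invp_lt1 : p%:R^-1 < 1 :> R.
Proof. by rewrite invf_lt1 ?p_gt0 // ltr1n prime_gt1. Qed.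

(** Bezout writes 1 as k p - a m, and both terms would have absolute value below 1 if m had. *)
Lemma abs_nat_coprime m : coprime p m -> abs m%:R = 1.
Proof.
move=> pm; apply/eqP; rewrite eq_le abs_nat_le1 leNgt; apply/negP => m1.
have [a _ /dvdnP[k E]] := Bezoutr m (prime_gt0 p_prime).
suff : abs (k%:R * p%:R - a%:R * m%:R) < 1.
  rewrite -!natrM -E gcdnC (eqP pm) natrD addrK abs1 ltxx //.
apply: abs_addr_lt; rewrite ?absN (absM absP) mulrC.
  rewrite (abs_prime absP); apply: le_lt_trans invp_lt1.
  by rewrite ler_piMr ?abs_nat_le1 // ltW ?invp_gt0.
by apply: le_lt_trans m1; rewrite ler_piMr ?abs_nat_le1 // (abs_ge0 absP).
Qed.

Lemma abs_natE m : (0 < m)%N -> abs m%:R = p%:R^-1 ^+ logn p m.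
Proof.
move=> m0; have [k pk E] := pfactor_coprime p_prime m0.
by rewrite {1}E natrM natrX (absM absP) absX (abs_prime absP) abs_nat_coprime ?mul1r.
Qed.

Lemma natr_neq0 m : m.+1%:R != 0 :> C.
Proof.
apply/eqP => H; have := abs_natE (ltn0Sn m); rewrite H abs0 => /esym/eqP.
by rewrite gt_eqF // exprn_gt0 // invp_gt0.
Qed.

Lemma abs_natX m : abs (p%:R ^+ m) = p%:R^-1 ^+ m.
Proof. by rewrite absX (abs_prime absP). Qed.

Lemma abs_nat_le_dvd k m : (abs m%:R <= p%:R^-1 ^+ k) = (p ^ k %| m)%N.
Proof.
have [->|m0] := posnP m; first by rewrite abs0 dvdn0 exprn_ge0 // ltW ?invp_gt0.
rewrite abs_natE // pfactor_dvdn //.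
by rewrite ler_iXn2l ?invp_gt0 ?invp_lt1.
Qed.

Lemma abs_int_le_dvd k (m : int) : (abs m%:~R <= p%:R^-1 ^+ k) = (p ^ k %| `|m|)%N.
Proof. by case: m => m; rewrite ?NegzE ?mulrNz ?absN abs_nat_le_dvd ?abszN. Qed.

Section Limits.
Local Open Scope classical_set_scope.

Lemma cvg_abs_le (u : nat -> C) (v : nat -> R) l :
  (forall n, abs (u n - l) <= v n) -> v n @[n --> \oo] --> (0 : R) -> cvg_abs abs u l.
Proof.
move=> uv v0; apply: (squeeze_cvgr _ (cvg_cst 0) v0).
by apply: nearW => n; rewrite (abs_ge0 absP) uv.
Qed.

(** Index 0 is excluded because a p-th root of unity theta satisfies theta^(p^N) = 1 only from N = 1
    on. *)
Lemma cvg_abs_near (u v : nat -> C) l :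
  (forall n, (0 < n)%N -> u n = v n) -> cvg_abs abs v l -> cvg_abs abs u l.
Proof.
move=> uv; apply: cvg_trans; apply: near_eq_cvg; near=> n; rewrite uv //.
by near: n; exists 1%N.
Unshelve. all: by end_near. Qed.

Lemma cvg_abs_cst (l : C) : cvg_abs abs (fun=> l) l.
Proof. by rewrite /cvg_abs subrr abs0; apply: cvg_cst. Qed.

Lemma cvg_absD u v l m : cvg_abs abs u l -> cvg_abs abs v m ->
  cvg_abs abs (fun n => u n + v n) (l + m).
Proof.
move=> ul vm; apply: (@cvg_abs_le _ (fun n => abs (u n - l) + abs (v n - m))) => [n|]; last first.
  by rewrite -[0]addr0; apply: cvgD.
rewrite (_ : _ - _ = (u n - l) + (v n - m)); last by ring.
apply: le_trans (abs_ultrametric absP _ _) _.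
by rewrite ge_max lerDl lerDr !(abs_ge0 absP).
Qed.

Lemma cvg_absM u v l m : cvg_abs abs u l -> cvg_abs abs v m ->
  cvg_abs abs (fun n => u n * v n) (l * m).
Proof.
move=> ul vm; apply: (@cvg_abs_le _ (fun n => abs (u n - l) * abs (v n - m) +
  (abs l * abs (v n - m) + abs (u n - l) * abs m))) => [n|]; last first.
  rewrite [0](_ : _ = 0 * 0 + (abs l * 0 + 0 * abs m)); last by ring.
  by apply: cvgD; [apply: cvgM|apply: cvgD; apply: cvgM => //; apply: cvg_cst].
rewrite -!(absM absP).
rewrite (_ : _ - _ = (u n - l) * (v n - m) + (l * (v n - m) + (u n - l) * m)); last by ring.
have := abs_ge0 absP ((u n - l) * (v n - m)).
have := abs_ge0 absP (l * (v n - m)); have := abs_ge0 absP ((u n - l) * m).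
have := abs_ultrametric absP ((u n - l) * (v n - m)) (l * (v n - m) + (u n - l) * m).
have := abs_ultrametric absP (l * (v n - m)) ((u n - l) * m).
by rewrite !le_max => /orP[] ? /orP[] ? ? ? ?; lra.
Qed.

Lemma cvg_absMl a u l : cvg_abs abs u l -> cvg_abs abs (fun n => a * u n) (a * l).
Proof. exact/cvg_absM/cvg_abs_cst. Qed.

Lemma cvg_abs_sum (I : Type) (s : seq I) (P : pred I) (u : I -> nat -> C) (l : I -> C) :
  (forall i, cvg_abs abs (u i) (l i)) ->
  cvg_abs abs (fun n => \sum_(i <- s | P i) u i n) (\sum_(i <- s | P i) l i).
Proof.
move=> ul; elim: s => [|i s IH].
  rewrite big_nil (_ : (fun _ => _) = fun=> 0); first exact: cvg_abs_cst.
  by apply/funext => n; rewrite big_nil.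
under [X in cvg_abs _ X]funext do rewrite big_cons.
by rewrite big_cons; case: (P i) => //; apply: cvg_absD.
Qed.

Lemma cvg_abs_prod (I : Type) (s : seq I) (P : pred I) (u : I -> nat -> C) (l : I -> C) :
  (forall i, cvg_abs abs (u i) (l i)) ->
  cvg_abs abs (fun n => \prod_(i <- s | P i) u i n) (\prod_(i <- s | P i) l i).
Proof.
move=> ul; elim: s => [|i s IH].
  rewrite big_nil (_ : (fun _ => _) = fun=> 1); first exact: cvg_abs_cst.
  by apply/funext => n; rewrite big_nil.
under [X in cvg_abs _ X]funext do rewrite big_cons.
by rewrite big_cons; case: (P i) => //; apply: cvg_absM.
Qed.

Lemma cvg_absX u l k : cvg_abs abs u l -> cvg_abs abs (fun n => u n ^+ k) (l ^+ k).
Proof.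
move=> ul; elim: k => [|k IH]; first exact: cvg_abs_cst.
by under [X in cvg_abs _ X]funext do rewrite exprS; rewrite exprS; apply: cvg_absM.
Qed.

Lemma cvg_abs_bounded0 u v : cvg_abs abs u 0 -> (forall n, abs (v n) <= 1) ->
  cvg_abs abs (fun n => v n * u n) 0.
Proof.
move=> u0 v1; apply: (@cvg_abs_le _ (fun n => abs (u n - 0)) _ _ u0) => n.
by rewrite !subr0 (absM absP) ler_piMl ?(abs_ge0 absP).
Qed.

Lemma cvg_abs_unique u l m : cvg_abs abs u l -> cvg_abs abs u m -> l = m.
Proof.
move=> ul um; apply/eqP; rewrite -subr_eq0; apply/eqP/(abs_eq0 absP).
have := cvg_absD um (cvg_absMl (-1) ul); rewrite /cvg_abs => H.
apply: (cvg_unique _ _ H) => //.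
rewrite (_ : (fun n => _) = fun=> abs (l - m)); first exact: cvg_cst.
by apply/funext => n; congr abs; ring.
Qed.

Lemma lim_absE u l : cvg_abs abs u l -> lim_abs abs u = l.
Proof.
move=> ul; rewrite /lim_abs; case: xgetP => [y _ /= uy|/(_ l)//].
exact: cvg_abs_unique uy ul.
Qed.

Lemma cvg_abs_limit_le u l x e : cvg_abs abs u l ->
  (\forall n \near \oo, abs (u n - x) <= e) -> abs (l - x) <= e.
Proof.
move=> ul ux; apply/ler_addgt0Pr => d d0.
have /cvgr_lt /(_ _ d0) := ul => ld.
near \oo => n.
rewrite (_ : l - x = (u n - x) - (u n - l)); last by ring.
have un : abs (u n - l) < d by near: n.
have unx : abs (u n - x) <= e by near: n.
apply: abs_subr_le; first by rewrite ler_wpDr // ltW.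
by rewrite ler_wpDl // ?(ltW un) // (le_trans _ unx) // (abs_ge0 absP).
Unshelve. all: by end_near. Qed.

Lemma cvg_exprn0 (a : R) : 0 <= a -> a < 1 -> a ^+ n @[n --> \oo] --> (0 : R).
Proof. by move=> a0 a1; apply: cvg_expr; rewrite ger0_norm. Qed.

(** By the ultrametric inequality, a decreasing bound on consecutive differences bounds all later
    differences as well, hence the distance to the limit, with the same constant. *)
Lemma geometric_cauchy u (K a : R) : 0 <= a -> a < 1 ->
  (forall n, abs (u n.+1 - u n) <= K * a ^+ n) ->
  exists2 l, cvg_abs abs u l & forall n, abs (l - u n) <= K * a ^+ n.
Proof.
move=> a0 a1 H.
have K0 : 0 <= K by have := le_trans (abs_ge0 absP _) (H 0%N); rewrite expr0 mulr1.
have H' n k : abs (u (n + k)%N - u n) <= K * a ^+ n.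
  elim: k => [|k IH]; first by rewrite addn0 subrr abs0 mulr_ge0 // exprn_ge0.
  rewrite (_ : _ - _ = (u (n + k.+1)%N - u (n + k)%N) + (u (n + k)%N - u n)); last by ring.
  apply: abs_addr_le => //; rewrite addnS; apply: le_trans (H _) _.
  by rewrite ler_wpM2l // ler_wiXn2l ?leq_addr // ltW.
have H2 n m : (n <= m)%N -> abs (u m - u n) <= K * a ^+ n.
  by move=> nm; rewrite -(subnKC nm).
have Ka0 : (K * a ^+ n) @[n --> \oo] --> (0 : R).
  by rewrite -[0](mulr0 K); apply: cvgM; [exact: cvg_cst|exact: cvg_exprn0].
have [l ul] : exists l, cvg_abs abs u l.
  apply: (abs_complete absP) => e e0.
  have /cvgr_lt /(_ _ e0)[N _ HN] := Ka0; exists N => m n Nm Nn.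
  apply: le_lt_trans (HN N (leqnn N)).
  rewrite (_ : u m - u n = (u m - u N) - (u n - u N)); last by ring.
  by apply: abs_subr_le; apply: H2.
exists l => // n; apply: (cvg_abs_limit_le ul).
by exists n => // m /= /H2.
Qed.

End Limits.

(** A rational q close to x has |q| <= 1, so its denominator is prime to p and can be inverted
    modulo p^k; this makes q congruent to a natural number. *)
Lemma padic_intP x : reflect (forall k, exists a : nat, abs (x - a%:R) <= p%:R^-1 ^+ k)
  `[< padic_int abs x >].
Proof.
apply: (iffP (asboolP _)) => [[xQ x1] k|H]; last first.
  split; last first.
    have [a] := H 0%N; rewrite expr0 => ax; rewrite -(subrK a%:R x).
    by apply: abs_addr_le ax _; apply: abs_nat_le1.
  move=> e e0; have /cvgr_lt /(_ _ e0)[k _ /(_ k (leqnn k)) ke] :=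
    cvg_exprn0 (ltW invp_gt0) invp_lt1.
  have [a ax] := H k; exists a%:Q; apply: le_lt_trans ke.
  by rewrite /ratr numq_int denq_int divr1.
have [q xq] := xQ _ (exprn_gt0 k invp_gt0).
set d := `|denq q|%N.
have dE : (denq q)%:~R = d%:R :> C by rewrite -[denq q]absz_denq.
have qE : ratr q * d%:R = (numq q)%:~R :> C.
  by rewrite /ratr dE mulfVK // -(prednK (_ : 0 < d)%N) ?natr_neq0 // absz_gt0 denq_neq0.
have q1 : abs (ratr q) <= 1.
  rewrite (_ : ratr q = x - (x - ratr q)); last by ring.
  by apply: abs_subr_le x1 _; apply: le_trans (ltW xq) _;
    rewrite exprn_ile1 ?ltW ?invp_gt0 ?invp_lt1.
have pd : coprime p d.
  rewrite prime_coprime //; apply/negP => pd.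
  have pn : (p %| `|numq q|)%N.
    rewrite -[p]expn1 -abs_int_le_dvd -qE (absM absP) -[leRHS]mul1r.
    by apply: ler_pM; rewrite ?(abs_ge0 absP) // abs_nat_le_dvd expn1.
  have : (p %| gcdn `|numq q| d)%N by rewrite dvdn_gcd pn pd.
  by rewrite (eqP (coprime_num_den q)) dvdn1 => /eqP p1; have := prime_gt1 p_prime; rewrite p1.
have pk0 : (0 < p ^ k)%N by rewrite expn_gt0 prime_gt0.
(* As p^k divides 1 + u d, the inverse of d modulo p^k is -u. This gives the integer [b] congruent
   to q, and its residue [a]. *)
have [u _ pu] := Bezoutr d pk0.
rewrite gcdnC (eqP (_ : coprime (p ^ k) d)) ?coprimeXl // in pu.
pose b : int := - numq q * u%:Z; pose a := (b %% (p ^ k)%:Z)%Z.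
have pk0z : (p ^ k)%:Z != 0 by rewrite -lt0n.
exists `|a|%N.
have -> : (`|a|%N)%:R = a%:~R :> C by rewrite pmulrn gez0_abs ?modz_ge0.
have -> : x - a%:~R = (x - ratr q) + ((ratr q - b%:~R) + (b - a)%:~R).
  by rewrite (mulrzBr 1 b a); move: (b%:~R : C) (a%:~R : C) => ? ?; ring.
apply: abs_addr_le; first exact: ltW.
apply: abs_addr_le; last first.
  rewrite abs_int_le_dvd /a {1}(divz_eq b (p ^ k)%:Z) addrK abszM.
  exact: dvdn_mull.
(* Multiplication by d, of absolute value 1, clears the denominator of q - b. *)
rewrite -[leLHS]mulr1 -[X in _ * X <= _](abs_nat_coprime pd) -(absM absP) mulrBl qE.
have -> : (numq q)%:~R - b%:~R * d%:R = (numq q * (1 + u * d)%N%:Z)%:~R :> C.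
  rewrite /b PoszD PoszM !(rmorphD, rmorphM, rmorphN) /= -!pmulrn.
  by move: ((numq q)%:~R : C) => ?; ring.
by rewrite abs_int_le_dvd abszM dvdn_mull.
Qed.

Lemma padic_int_of_int x :
  (forall k, exists a : int, abs (x - a%:~R) <= p%:R^-1 ^+ k) -> padic_int abs x.
Proof.
move=> H; apply/asboolP/padic_intP => k; have [b xb] := H k.
have pk0z : (p ^ k)%:Z != 0 by rewrite -lt0n expn_gt0 prime_gt0.
pose a := (b %% (p ^ k)%:Z)%Z; exists `|a|%N.
have -> : (`|a|%N)%:R = a%:~R :> C by rewrite pmulrn gez0_abs ?modz_ge0.
have -> : x - a%:~R = (x - b%:~R) + (b - a)%:~R.
  by rewrite (mulrzBr 1 b a); move: (b%:~R : C) (a%:~R : C) => ? ?; ring.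
apply: abs_addr_le => //; rewrite abs_int_le_dvd /a {1}(divz_eq b (p ^ k)%:Z) addrK abszM.
exact: dvdn_mull.
Qed.

Lemma padic_int_approx x k : padic_int abs x -> exists a : nat, abs (x - a%:R) <= p%:R^-1 ^+ k.
Proof. by move/asboolP/padic_intP. Qed.

Lemma padic_int_int (a : int) : padic_int abs a%:~R.
Proof.
apply: padic_int_of_int => k; exists a; rewrite subrr abs0.
by rewrite exprn_ge0 // ltW ?invp_gt0.
Qed.

Lemma padic_int_nat (a : nat) : padic_int abs a%:R.
Proof. exact: (padic_int_int a). Qed.

Lemma padic_intD x y : padic_int abs x -> padic_int abs y -> padic_int abs (x + y).
Proof.
move=> xZ yZ; apply: padic_int_of_int => k.
have [a xa] := padic_int_approx k xZ; have [b yb] := padic_int_approx k yZ.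
exists (a + b)%N%:Z; rewrite PoszD rmorphD /=.
rewrite (_ : _ - _ = (x - a%:R) + (y - b%:R)); last by ring.
exact: abs_addr_le.
Qed.

Lemma padic_intM x y : padic_int abs x -> padic_int abs y -> padic_int abs (x * y).
Proof.
move=> xZ yZ; apply: padic_int_of_int => k.
have [a xa] := padic_int_approx k xZ; have [b yb] := padic_int_approx k yZ.
exists (a * b)%N%:Z; rewrite PoszM rmorphM /=.
rewrite (_ : _ - _ = x * (y - b%:R) + b%:R * (x - a%:R)); last by ring.
apply: abs_addr_le; rewrite (absM absP) -[leRHS]mul1r.
  by apply: ler_pM; rewrite ?(abs_ge0 absP) //; case: xZ.
by apply: ler_pM; rewrite ?(abs_ge0 absP) // abs_nat_le1.
Qed.

Lemma padic_intN x : padic_int abs x -> padic_int abs (- x).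
Proof. by move=> xZ; rewrite -mulN1r; apply: padic_intM => //; apply: (padic_int_int (-1)). Qed.

Lemma padic_intX x k : padic_int abs x -> padic_int abs (x ^+ k).
Proof.
move=> xZ; elim: k => [|k IH]; first exact: (padic_int_nat 1).
by rewrite exprS; apply: padic_intM.
Qed.

Lemma padic_int_lim u l : (forall n, padic_int abs (u n)) -> cvg_abs abs u l -> padic_int abs l.
Proof.
move=> uZ ul; apply: padic_int_of_int => k.
have /cvgr_lt /(_ _ (exprn_gt0 k invp_gt0))[N _ /(_ N (leqnn N)) /= lN] := ul.
have [a ua] := padic_int_approx k (uZ N); exists a%:Z.
rewrite (_ : _ - _ = (u N - a%:R) - (u N - l)); last by rewrite -pmulrn; ring.
by apply: abs_subr_le => //; apply: ltW.
Qed.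

Lemma padic_multipleP m x : padic_int abs x ->
  padic_multiple abs (p ^ m) x <-> abs x <= p%:R^-1 ^+ m.
Proof.
move=> xZ; split=> [[y [_ y1] ->]|x1].
  by rewrite (absM absP) natrX abs_natX ler_piMr // exprn_ge0 // ltW ?invp_gt0.
have pm0 : p%:R ^+ m != 0 :> C.
  by rewrite expf_neq0 // -(prednK (prime_gt0 p_prime)) natr_neq0.
exists (x / p%:R ^+ m); last by rewrite natrX mulrC mulfVK.
apply: padic_int_of_int => k.
(* The precision m + k pays for the division by p^m: an approximant this close to x is itself
   divisible by p^m. *)
have [a xa] := padic_int_approx (m + k) xZ.
have /dvdnP[b ab] : (p ^ m %| a)%N.
  rewrite -abs_nat_le_dvd (_ : a%:R = x - (x - a%:R)); last by ring.
  apply: abs_subr_le x1 _; apply: le_trans xa _.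
  by rewrite ler_iXn2l ?leq_addr ?invp_gt0 ?invp_lt1.
exists b%:Z; rewrite -pmulrn.
have -> : x / p%:R ^+ m - b%:R = (x - a%:R) / p%:R ^+ m by rewrite ab natrM natrX; field.
rewrite (absM absP) absV abs_natX -exprVn invrK.
rewrite -ler_pdivlMr ?exprn_gt0 ?p_gt0 // -exprVn.
by rewrite mulrC -exprD.
Qed.

End PadicAbs.

(** * Powers with natural exponents *)

(** Combined with Legendre's formula this gives (p - 1) v_p(n!) <= n - 1. The term [maxn 1 _]
    carries the induction and, never falling below 1, supplies the final -1. *)
Lemma legendre_bound p n m : (0 < p)%N -> (0 < n)%N ->
  (p.-1 * (\sum_(1 <= i < m.+1) n %/ p ^ i) + maxn 1 (n %/ p ^ m) <= n)%N.
Proof.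
move=> p0 n0; elim: m => [|m IH].
  by rewrite big_geq // muln0 expn0 divn1 add0n geq_max n0 leqnn.
apply: leq_trans IH; rewrite big_nat_recr //= mulnDr -addnA leq_add2l.
rewrite expnSr divnMA; have := leq_trunc_div (n %/ p ^ m) p.
move: (n %/ p ^ m)%N => a; have : (a %/ p <= a)%N by apply: leq_div.
move: (a %/ p)%N => b; nia.
Qed.

(** From (p - 1) v <= k and p <= 2^(p-1). The bound is uniform in p, and it is the origin of the
    radius 1/2 in the convergence estimates for exp and log. *)
Lemma p_part_fact_le p k : prime p -> (p ^ logn p (k.+1)`! <= 2 ^ k)%N.
Proof.
move=> pp; have p0 := prime_gt0 pp.
have E : (p.-1 * logn p (k.+1)`! <= k)%N.
  rewrite logn_fact //; have := @legendre_bound p k.+1 k.+1 p0 isT.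
  move: (maxn _ _) (leq_maxl 1 (k.+1 %/ p ^ k.+1)) => x x1.
  by move=> H; rewrite -ltnS; apply: leq_trans H; rewrite -addn1 leq_add2l.
apply: (@leq_trans ((2 ^ p.-1) ^ logn p (k.+1)`!)); last by rewrite -expnM leq_exp2l.
case: (logn _ _) => // v; rewrite leq_exp2r //.
by rewrite -{1}(prednK p0); apply: ltn_expl.
Qed.

Section PadicPow.
Variables (R : realType) (p : nat) (C : fieldType) (abs : C -> R).
Hypotheses (p_prime : prime p) (absP : is_Cp p abs).

Let abs_ge0 x : 0 <= abs x := abs_ge0 absP x.
Let absM x y : abs (x * y) = abs x * abs y := absM absP x y.
Let abs_addr_le := abs_addr_le absP.
Let abs_sum_le := abs_sum_le absP.
Let natr_neq0 := natr_neq0 p_prime absP.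

Lemma abs_inv_fact_le k : abs ((k.+1)`!%:R^-1) <= 2 ^+ k.
Proof.
rewrite (absV absP) (abs_natE p_prime absP) ?fact_gt0 // -exprVn invrK -!natrX ler_nat.
exact: p_part_fact_le.
Qed.

Lemma abs_inv_nat_le k : abs (k.+1%:R^-1) <= 2 ^+ k.
Proof.
apply: le_trans (abs_inv_fact_le k); rewrite factS natrM invfM absM.
rewrite ler_peMr // (absV absP) invf_ge1 ?(abs_nat_le1 absP) // (abs_gt0 absP) //.
by case: k`! (fact_gt0 k).
Qed.

(** A bound on the Gauss norm for the disc of radius 1/2, which is submultiplicative by the
    ultrametric inequality. *)
Definition coef_bound (P : {poly C}) (a : R) := forall m, abs P`_m <= a * 2 ^+ m.

Lemma coef_boundM P Q a b : 0 <= a -> 0 <= b ->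
  coef_bound P a -> coef_bound Q b -> coef_bound (P * Q) (a * b).
Proof.
move=> a0 b0 Pa Qb m; rewrite coefM; apply: abs_sum_le => [|i _].
  by rewrite !mulr_ge0 ?exprn_ge0 ?ler0n.
have -> : 2 ^+ m = 2 ^+ i * 2 ^+ (m - i) :> R by rewrite -exprD subnKC // -ltnS.
by rewrite absM mulrACA ler_pM.
Qed.

Lemma coef_bound1 : coef_bound 1 1.
Proof.
move=> m; rewrite coef1 mul1r; apply: le_trans (abs_nat_le1 absP _) _.
by rewrite exprn_ege1 // ler1n.
Qed.

Lemma coef_boundX P a k : 0 <= a -> coef_bound P a -> coef_bound (P ^+ k) (a ^+ k).
Proof.
move=> a0 Pa; elim: k => [|k IH]; first exact: coef_bound1.
by rewrite !exprS; apply: coef_boundM; rewrite ?exprn_ge0.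
Qed.

Lemma horner_tail_le (P : {poly C}) t M : coef_bound P 1 ->
  (forall m, (m < M)%N -> P`_m = 0) -> 2 * abs t <= 1 ->
  abs P.[t] <= (2 * abs t) ^+ M.
Proof.
move=> Pb P0 t1; have t0 : 0 <= 2 * abs t by rewrite mulr_ge0.
rewrite horner_coef; apply: abs_sum_le => [|i _]; first by rewrite exprn_ge0.
have [iM|Mi] := ltnP i M; first by rewrite P0 // mul0r (abs0 absP) exprn_ge0.
apply: (@le_trans _ _ ((2 * abs t) ^+ i)); last by rewrite ler_wiXn2l.
rewrite absM (absX absP) exprMn ler_wpM2r ?exprn_ge0 //.
by have := Pb i; rewrite mul1r.
Qed.

(* The constant coefficient vanishes since 0^-1 = 0. *)
Definition log_poly M : {poly C} := \poly_(k < M) ((-1) ^+ k.-1 / k%:R).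

Definition exp_poly M (Y : {poly C}) : {poly C} := \sum_(k < M) (k`!)%:R^-1 *: Y ^+ k.

Lemma deriv_log_poly N : (1 + 'X) * (log_poly N.+1)^`() = 1 - (- 'X) ^+ N.
Proof.
have -> : (log_poly N.+1)^`() = \sum_(k < N) (- 'X) ^+ k.
  transitivity (\poly_(k < N) ((-1) ^+ k : C)).
    apply/polyP => k; rewrite coef_deriv !coef_poly ltnS; case: ltnP; rewrite ?mul0rn // => _.
    by rewrite -[LHS]mulr_natr mulfVK.
  rewrite poly_def; apply: eq_bigr => k _.
  by rewrite -[- 'X]mulN1r exprMn -mul_polyC polyC_exp polyCN.
by rewrite -[1 - _]opprB subrX1 -mulNr opprB opprK.
Qed.

Lemma log_polyX N : exists L, log_poly N = 'X * L.
Proof.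
exists (\poly_(k < N.-1) ((-1) ^+ k / k.+1%:R)).
apply/polyP => -[|k]; rewrite coefXM !coef_poly /=.
  by rewrite invr0 mulr0 if_same.
by case: N.
Qed.

Lemma deriv_exp_poly N (Y : {poly C}) :
  (exp_poly N.+1 Y)^`() = Y^`() * (exp_poly N.+1 Y - (N`!)%:R^-1 *: Y ^+ N).
Proof.
rewrite /exp_poly raddf_sum /= big_ord_recl /= [in RHS]big_ord_recr /= addrK.
rewrite derivZ expr0 derivC scaler0 add0r mulr_sumr; apply: eq_bigr => k _.
rewrite derivZ deriv_exp /= -scalerAr -scaler_nat scalerA factS natrM mulrC.
by rewrite /bump /= add1n invfM mulVKf.
Qed.

(* Both sides solve (1 + X) F' = n F modulo X^M, with F(0) = 1. *)
Lemma exp_log_poly n M m : (m < M)%N ->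
  (exp_poly M (n%:R *: log_poly M) - (1 + 'X) ^+ n)`_m = 0.
Proof.
case: M => // N; set L := log_poly _; set F := exp_poly _ _.
set G := (1 + 'X) ^+ n; set H := F - G.
have [L1 LE] := log_polyX N.+1.
(* Truncation spoils the differential equation only by multiples of X^N: the error of log is (-X)^N,
   and that of exp involves the N-th power of [L], which has no constant term. *)
have [Z HZ] : exists Z, (1 + 'X) * H^`() - n%:R *: H = 'X^N * Z.
  exists (n%:R *: (- (-1) ^+ N * F - ((N`!)%:R^-1) *: (n%:R *: L1) ^+ N
     + (-1) ^+ N * (((N`!)%:R^-1) *: (n%:R *: L) ^+ N))).
  have GE : (1 + 'X) * G^`() = n%:R *: G.
    rewrite /G; case: (n) => [|k]; first by rewrite expr0 derivC scale0r mulr0.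
    rewrite deriv_exp derivD derivC derivX add0r /= mul1r.
    by rewrite mulrnAr -exprS scaler_nat.
  have FE : (1 + 'X) * F^`() = n%:R *: ((1 - (- 'X) ^+ N) * (F - (N`!)%:R^-1 *: (n%:R *: L) ^+ N)).
    by rewrite deriv_exp_poly derivZ -/F mulrA -scalerAr deriv_log_poly -scalerAl.
  have LN : (n%:R *: L) ^+ N = 'X^N * (n%:R *: L1) ^+ N.
    by rewrite /L LE scalerAr exprMn.
  rewrite /H derivB mulrBr FE GE -[- 'X]mulN1r exprMn LN -!mul_polyC.
  by ring.
elim: m => [_|m IH mN].
  rewrite /H coefB -!horner_coef0 /F /exp_poly horner_sum big_ord_recl /= invr1 scale1r.
  rewrite expr0 hornerC big1 ?addr0; last first.
    by move=> i _; rewrite /L LE !hornerE /= !(mul0r, mulr0) exprS !mul0r mulr0.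
  by rewrite /G !hornerE /= expr1n subrr.
(* Below degree N the coefficient of X^m reads (m + 1) H_(m+1) + (m - n) H_m = 0, and m + 1 is
   nonzero in C. *)
have := congr1 (fun P : {poly C} => P`_m) HZ.
rewrite coefXnM (_ : (m < N)%N) // coefB coefZ IH ?mulr0 ?subr0; last exact: ltnW.
rewrite mulrDl mul1r coefD coefXM !coef_deriv.
have -> : (if m == 0 then 0 else H`_m.-1.+1 *+ m.-1.+1) = 0.
  by case: m IH mN => [|m] IH mN //=; rewrite IH ?mul0rn // ltnW.
by rewrite addr0 -mulr_natr => /eqP; rewrite mulf_eq0 (negPf (natr_neq0 m)) orbF => /eqP.
Qed.

(** Since |1/k| <= 2^(k-1), [log_poly] has Gauss norm at most 1/2; its k-th power then has norm at
    most 2^-k, which absorbs |1/k!| <= 2^(k-1). *)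
Lemma coef_bound_exp_log n M m : abs (exp_poly M (n%:R *: log_poly M) - (1 + 'X) ^+ n)`_m <= 2 ^+ m.
Proof.
have h0 : 0 <= 2^-1 :> R by rewrite invr_ge0 ler0n.
have e0 k : 0 <= 2 ^+ k :> R by rewrite exprn_ge0 // ler0n.
have Lb : coef_bound (n%:R *: log_poly M) 2^-1.
  move=> k; rewrite coefZ coef_poly; case: ltnP => _; last by rewrite mulr0 (abs0 absP) mulr_ge0.
  case: k => [|k]; first by rewrite invr0 !mulr0 (abs0 absP) mulr_ge0.
  rewrite [2 ^+ _]exprS mulKf ?pnatr_eq0 // !absM.
  rewrite (absX absP) (absN absP) (abs1 absP) expr1n mul1r.
  apply: le_trans (abs_inv_nat_le k); rewrite ler_piMl //; exact: (abs_nat_le1 absP).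
rewrite coefB; apply: (abs_subr_le absP).
  rewrite /exp_poly coef_sum; apply: abs_sum_le => // k _; rewrite coefZ absM.
  case: k => -[|k] /= _.
    rewrite invr1 (abs1 absP) mul1r expr0.
    by have := coef_bound1 m; rewrite mul1r.
  have := coef_boundX k.+1 h0 Lb m => H.
  have := ler_pM (abs_ge0 _) (abs_ge0 _) (abs_inv_fact_le k) H; move/le_trans; apply.
  rewrite mulrA ler_piMl // exprVn exprS invfM mulrCA divff ?mulr1 ?expf_neq0 ?pnatr_eq0 //.
  by rewrite invf_le1 // ler1n.
have : coef_bound ((1 + 'X) ^+ n) (1 ^+ n).
  apply: coef_boundX; first exact: ler01.
  case=> [|[|i]]; rewrite coefD coef1 coefX ?(addr0, add0r) ?(abs1 absP) ?(abs0 absP).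
  - by rewrite mul1r.
  - by rewrite mul1r ler1n.
  - by rewrite mul1r e0.
by move/(_ m); rewrite expr1n mul1r.
Qed.

Lemma abs_subrXX x y d k : abs x <= d -> abs y <= d ->
  abs (x ^+ k.+1 - y ^+ k.+1) <= abs (x - y) * d ^+ k.
Proof.
move=> xd yd; have d0 := le_trans (abs_ge0 x) xd.
rewrite subrXX absM ler_wpM2l //; apply: abs_sum_le => [|i _]; first exact: exprn_ge0.
rewrite absM !(absX absP) (_ : d ^+ k = d ^+ (k - i) * d ^+ i); last first.
  by rewrite -exprD subnK // -ltnS.
by rewrite ler_pM ?exprn_ge0 // lerXn2r ?nnegrE.
Qed.

(** The exponential is evaluated at x = log u, itself a limit. Replacing x by the partial sum [l N]
    costs at most b^N; the polynomial so obtained differs from (1 + X)^n only in degrees at least N,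
    which costs at most b^N again. *)
Lemma padic_pow_nat u n : 2 * abs (u - 1) < 1 -> padic_pow abs u n%:R = u ^+ n.
Proof.
set t := u - 1; set d := abs t; set b := 2 * d => b1.
have d0 : 0 <= d := abs_ge0 t; have b0 : 0 <= b by rewrite mulr_ge0.
have bX0 k : 0 <= b ^+ k by rewrite exprn_ge0.
have bX1 k : b ^+ k <= 1 by rewrite exprn_ile1 // ltW.
pose l N := (log_poly N).[t].
have lE N : l N = \sum_(k < N) (-1) ^+ k.-1 / k%:R * t ^+ k by exact: horner_poly.
have termE k : abs ((-1) ^+ k / k.+1%:R * t ^+ k.+1) <= d * b ^+ k.
  rewrite !absM !(absX absP) (absN absP) (abs1 absP) expr1n mul1r exprS mulrCA.
  by rewrite ler_wpM2l // exprMn ler_wpM2r ?exprn_ge0 // abs_inv_nat_le.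
have [x lx xl] : exists2 x, cvg_abs abs l x & forall N, abs (x - l N) <= 1 * b ^+ N.
  apply: (geometric_cauchy absP) => // N.
  rewrite !lE big_ord_recr /= addrAC subrr add0r.
  case: N => [|N]; first by rewrite invr0 mulr0 mul0r (abs0 absP) mulr_ge0.
  apply: le_trans (termE N) _; rewrite mul1r exprS ler_wpM2r //.
  by rewrite /b ler_peMl // ler1n.
have ld N : abs (l N) <= d.
  rewrite lE; apply: abs_sum_le => // -[[|k] /= _] _.
    by rewrite invr0 mulr0 mul0r (abs0 absP).
  by apply: le_trans (termE k) _; rewrite ler_piMr.
have xd : abs x <= d.
  rewrite -[x]subr0; apply: (cvg_abs_limit_le absP lx).
  by apply: nearW => N; rewrite subr0.
have xE : padic_log abs u = x.
  apply: (lim_absE absP); apply: (cvg_abs_near _ lx) => -[//|N] _.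
  rewrite lE big_ord_recl /= invr0 mulr0 mul0r add0r big_add1 big_mkord.
  by apply: eq_bigr => k _; rewrite mulrAC.
rewrite /padic_pow xE; apply: (lim_absE absP).
apply: (@cvg_abs_le _ _ _ _ absP _ (fun N => b ^+ N)) (cvg_exprn0 b0 b1) => N.
pose P := exp_poly N (n%:R *: log_poly N).
rewrite (_ : _ - _ = (\sum_(0 <= k < N) (n%:R * x) ^+ k / k`!%:R - P.[t]) +
  (P - (1 + 'X) ^+ n).[t]); last first.
  have -> : (P - (1 + 'X) ^+ n).[t] = P.[t] - u ^+ n.
    by rewrite hornerD hornerN horner_exp hornerD hornerC hornerX (_ : 1 + t = u) // /t addrC subrK.
  by rewrite addrA subrK.
apply: abs_addr_le; last first.
  apply: horner_tail_le; [|exact: exp_log_poly|exact: ltW].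
  by move=> m; rewrite mul1r; apply: coef_bound_exp_log.
rewrite /P /exp_poly horner_sum big_mkord -sumrB; apply: abs_sum_le => // -[[|k] /= _] _.
  by rewrite !expr0 invr1 mulr1 scale1r hornerC subrr (abs0 absP).
rewrite !hornerE /= -/(l N) mulrC -mulrBr absM.
have nx y : abs y <= d -> abs (n%:R * y) <= d.
  by move=> yd; rewrite absM; apply: le_trans yd; rewrite ler_piMl // (abs_nat_le1 absP).
(* The d^k from the difference of (k+1)-th powers and the 2^k bounding |1/(k+1)!| combine to b^k <=
   1, so that only |x - l N| is left. *)
apply: le_trans (ler_pM _ _ (abs_inv_fact_le k) (abs_subrXX k (nx _ xd) (nx _ (ld N)))) _ => //.
rewrite mulrCA -exprMn -/b -mulrBr absM -mulrA.
apply: le_trans (ler_piMl _ (abs_nat_le1 absP n)) _; first by rewrite mulr_ge0.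
have := xl N; rewrite mul1r; apply: le_trans.
by rewrite ler_piMr.
Qed.

End PadicPow.

(** * Teichmueller representatives *)

Section Teichmuller.
Variables (R : realType) (p : nat) (C : fieldType) (abs : C -> R).
Hypotheses (p_prime : prime p) (absP : is_Cp p abs).

Let abs_ge0 x : 0 <= abs x := abs_ge0 absP x.
Let absM x y : abs (x * y) = abs x * abs y := absM absP x y.
Let abs_addr_le := abs_addr_le absP.
Let abs_subr_le := abs_subr_le absP.
Let abs_sum_le := abs_sum_le absP.
Let invp_gt0 : 0 < p%:R^-1 :> R := invp_gt0 R p_prime.
Let invp_lt1 : p%:R^-1 < 1 :> R := invp_lt1 R p_prime.

(** In x^p - y^p = (x - y) S the cofactor S is congruent to p y^(p-1) modulo x - y, hence divisible
    by p; this gains one digit. *)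
Lemma abs_frobenius x y k : abs x <= 1 -> abs y <= 1 ->
  abs (x - y) <= p%:R^-1 ^+ k.+1 -> abs (x ^+ p - y ^+ p) <= p%:R^-1 ^+ k.+2.
Proof.
move=> x1 y1 xy; rewrite subrXX absM [p%:R^-1 ^+ k.+2]exprSr ler_pM //.
have xyp : abs (x - y) <= p%:R^-1.
  by apply: le_trans xy _; rewrite exprS ler_piMr ?exprn_ile1 ?ltW.
rewrite (_ : \sum_(i < p) _ = \sum_(i < p) (x ^+ (p.-1 - i) - y ^+ (p.-1 - i)) * y ^+ i
   + p%:R * y ^+ p.-1); last first.
  rewrite mulr_natl -[X in _ *+ X](card_ord p) -sumr_const -big_split /=.
  apply: eq_bigr => i _; rewrite mulrBl -exprD subnK ?subrK //.
  by rewrite -ltnS prednK ?prime_gt0.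
apply: abs_addr_le; last first.
  by rewrite absM (abs_prime absP) ler_piMr ?(absX absP) ?exprn_ile1 // ltW.
apply: abs_sum_le => [|i _]; first exact: ltW.
rewrite absM -[leRHS]mulr1 ler_pM //; last by rewrite (absX absP) exprn_ile1.
case: (p.-1 - i)%N => [|j]; first by rewrite subrr (abs0 absP) ltW.
by have := abs_subrXX absP j x1 y1; rewrite expr1n mulr1 => /le_trans; apply.
Qed.

(** Absolute values on Z_p are discrete: y is congruent modulo p to a natural number a, and either p
    divides a or |a| = 1. *)
Lemma padic_unit_abs y : padic_int abs y -> ~ padic_multiple abs p y -> abs y = 1.
Proof.
move=> yZ; rewrite -{1}[p]expn1 => H.
have {}H : ~ abs y <= p%:R^-1 ^+ 1 by move/(padic_multipleP p_prime absP 1 yZ).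
have [a ya] := padic_int_approx p_prime absP 1 yZ.
apply/eqP; rewrite eq_le (proj2 yZ) /= leNgt; apply/negP => y1; apply: H.
rewrite -(subrK a%:R y); apply: abs_addr_le => //.
rewrite (abs_nat_le_dvd p_prime absP) expn1; apply: contraT => pa.
have := abs_nat_coprime p_prime absP (_ : coprime p a); rewrite prime_coprime // => /(_ pa) a1.
suff : abs a%:R < 1 by rewrite a1 ltxx.
rewrite (_ : a%:R = y + - (y - a%:R)); last by ring.
by apply: (abs_addr_lt absP) => //; rewrite (absN absP); apply: le_lt_trans ya _; rewrite expr1.
Qed.

(** This provides the witness for the [xget] in [teichmuller]: the sign congruent to y modulo 4 if p
    = 2, the limit of y^(p^n) otherwise. *)
Let padic_W_unit y : padic_int abs y -> abs y = 1 -> exists2 w,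
  padic_W p abs w & [/\ padic_int abs w, padic_int abs w^-1, w != 0 &
    abs (y - w) <= abs (padic_q p)%:R].
Proof.
move=> yZ y1; rewrite /padic_W /padic_q; case: eqP => p2.
  have [a ya] := padic_int_approx p_prime absP 2 yZ.
  have pa : odd a.
    apply: contraT; rewrite -dvdn2 -p2 => pa.
    have : abs a%:R < 1.
      apply: le_lt_trans invp_lt1; rewrite -[leRHS]expr1.
      by rewrite (abs_nat_le_dvd p_prime absP) expn1.
    suff -> : abs a%:R = 1 by rewrite ltxx.
    apply/eqP; rewrite eq_le (abs_nat_le1 absP) leNgt; apply/negP => a1.
    suff : abs y < 1 by rewrite y1 ltxx.
    rewrite -(subrK a%:R y); apply: (abs_addr_lt absP) => //.
    by apply: le_lt_trans ya _; rewrite exprn_ilt1 ?ltW.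
  have q4 : abs 4%:R = p%:R^-1 ^+ 2.
    by rewrite (_ : 4 = p%:R ^+ 2) ?(abs_natX absP) // p2 -natrX.
  have [w w1 aw] : exists2 w : int, w = 1 \/ w = -1 & (2 ^ 2 %| `|a%:Z - w|)%N.
    have [a1|a1] := eqVneq (a %% 4)%N 1%N; first by exists 1; [left|move: a1; clear; lia].
    by exists (-1); [right|move: a1 pa; clear; lia].
  have {}w1 : w%:~R = 1 :> C \/ w%:~R = -1 :> C by case: w1 => ->; [left|right].
  have wV : (w%:~R)^-1 = w%:~R :> C by case: w1 => wE; rewrite wE ?invr1 ?invrN1.
  exists w%:~R; first exact: w1.
  split.
  - exact: (padic_int_int p_prime absP).
  - by rewrite wV; apply: (padic_int_int p_prime absP).
  - by case: w1 => wE; rewrite wE ?oppr_eq0 oner_eq0.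
  rewrite q4 (_ : y - _ = (y - a%:R) + (a%:Z - w)%:~R); last by rewrite rmorphB /= -pmulrn; ring.
  by apply: abs_addr_le => //; rewrite (abs_int_le_dvd p_prime absP) p2.
(* Fermat's little theorem makes the first difference divisible by p, and each further p-th power
   gains a digit. The limit w satisfies w^p = w and is congruent to y modulo p. *)
pose w_ n := y ^+ (p ^ n).
have wZ n : padic_int abs (w_ n) by apply: (padic_intX p_prime absP).
have wS n : w_ n.+1 = w_ n ^+ p by rewrite /w_ expnSr exprM.
have w0 : abs (w_ 1%N - w_ 0%N) <= p%:R^-1 ^+ 1.
  have [a ya] := padic_int_approx p_prime absP 1 yZ.
  rewrite /w_ expn0 expn1 expr1.
  rewrite (_ : _ - _ = (y ^+ p - a%:R ^+ p) + ((a%:R ^+ p - a%:R) - (y - a%:R))); last by ring.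
  apply: abs_addr_le; last apply: abs_subr_le => //.
    apply: (le_trans (abs_frobenius (k := 0) _ (abs_nat_le1 absP a) ya)); first exact: (proj2 yZ).
    by rewrite ler_iXn2l.
  have ap : (a <= a ^ p)%N by case: (a) => // b; apply: leq_pexp2l (prime_gt0 p_prime).
  rewrite -natrX -natrB // (abs_nat_le_dvd p_prime absP) expn1 -eqn_mod_dvd //.
  exact/eqP/fermat_little.
have wC n : abs (w_ n.+1 - w_ n) <= p%:R^-1 * p%:R^-1 ^+ n.
  rewrite -exprS; elim: n => // n IH; rewrite !(wS n.+1) {2}wS.
  by apply: abs_frobenius => //; [exact: (proj2 (wZ n.+1))|exact: (proj2 (wZ n))].
have [w ww wE] := geometric_cauchy absP (ltW invp_gt0) invp_lt1 wC.
have wZ' : padic_int abs w by apply: (padic_int_lim p_prime absP _ ww).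
have wy : abs (y - w) <= p%:R^-1.
  by rewrite (absB absP); have := wE 0%N; rewrite expr0 mulr1 /w_ expn0 expr1.
have wp : w ^+ p = w.
  have wp := cvg_absX absP p ww; apply: (cvg_abs_unique absP wp).
  apply: (@cvg_abs_le _ _ _ _ absP _ (fun n => p%:R^-1 ^+ n.+1 * p%:R^-1)) => [n|].
    rewrite -wS (absB absP); by apply: le_trans (wE n.+1) _; rewrite mulrC.
  rewrite -[0](mul0r p%:R^-1); apply: cvgM; last exact: cvg_cst.
  under eq_fun do rewrite exprS.
  rewrite -[0](mulr0 p%:R^-1); apply: cvgM; first exact: cvg_cst.
  exact: cvg_exprn0 (ltW invp_gt0) invp_lt1.
have w_neq0 : w != 0.
  apply/eqP => w00; have := wy; rewrite w00 subr0 y1.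
  by rewrite leNgt invp_lt1.
have wp1 : w ^+ p.-1 = 1.
  by apply: (mulfI w_neq0); rewrite -exprS prednK ?prime_gt0 // wp mulr1.
have p3 : (1 < p.-1)%N by have := prime_gt1 p_prime; lia.
have wV : w^-1 = w ^+ p.-2.
  by apply: (mulfI w_neq0); rewrite divff // -exprS prednK ?wp1 // ltnW.
have wVZ : padic_int abs w^-1 by rewrite wV; apply: (padic_intX p_prime absP).
by exists w => //; split=> //; rewrite (abs_prime absP).
Qed.

(** Whichever w is selected, y = w u with |u - 1| <= |q| < 1/2. Hence <y> = u, [padic_pow_nat] gives
    u^n, and u^n w^n = y^n. *)
Lemma teichmuller_pow y n : padic_int abs y -> ~ padic_multiple abs p y ->
  padic_pow abs (angle p abs y) n%:R * teichmuller p abs y ^ n%:Z = y ^+ n.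
Proof.
move=> yZ py; have y1 := padic_unit_abs yZ py.
have y0 : y != 0 by apply/eqP => y0; move/eqP: y1; rewrite y0 (abs0 absP) eq_sym oner_eq0.
have [e qE] : exists e, padic_q p = (p ^ e)%N.
  by rewrite /padic_q; case: eqP => [->|_]; [exists 2%N|exists 1%N; rewrite expn1].
have q2 : 2 * abs (padic_q p)%:R < 1.
  have p0 := prime_gt0 p_prime; have p1 := prime_gt1 p_prime.
  rewrite /padic_q; case: eqP => [p2|/eqP p2].
    rewrite (_ : 4 = p%:R ^+ 2) ?(abs_natX absP) ?p2 -?natrX //.
    by rewrite expr2; lra.
  by rewrite (abs_prime absP) ltr_pdivrMr ?mul1r ?ltr0n // ltr_nat; lia.
rewrite /angle /teichmuller; case: xgetP => [w _ /= [wW [u uq yE]]|H].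
  have w0 : w != 0 by apply: contra_neq y0 => w0; rewrite yE w0 mul0r.
  have -> : y / w = u by rewrite yE mulrAC divff // mul1r.
  rewrite (padic_pow_nat p_prime absP); first by rewrite -exprnP -exprMn mulrC -yE.
  apply: le_lt_trans q2; rewrite ler_wpM2l //.
  case: uq => z [_ z1] ->; rewrite absM ler_piMr //.
have [w wW [wZ wVZ w0 wy]] := padic_W_unit yZ y1.
case: (H w); split=> //; exists (y / w); last by rewrite mulrC divfK.
have -> : y / w - 1 = (y - w) / w by rewrite mulrBl divff.
have ywZ : padic_int abs (y - w).
  by apply: (padic_intD p_prime absP) => //; apply: (padic_intN p_prime absP).
rewrite qE; apply/(padic_multipleP p_prime absP); first exact: (padic_intM p_prime absP).
apply: le_trans (_ : abs (y - w) <= _); last by move: wy; rewrite qE natrX (abs_natX absP).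
by rewrite absM ler_piMr //; case: wVZ.
Qed.

End Teichmuller.

(** * Moments of the twisted measures *)

Section Moments.
Variables (R : realType) (p : nat) (C : fieldType) (abs : C -> R).
Hypotheses (p_prime : prime p) (absP : is_Cp p abs).
Variable r : nat.
Implicit Types (n : 'I_r -> nat) (gamma eta : 'I_r -> C).

Let natr_neq0 := natr_neq0 p_prime absP.

Definition mser_cvg (F : nat -> mseries r C) (f : mseries r C) :=
  forall n, cvg_abs abs (fun N => F N n) (f n).

Lemma mser_cvgM F G f g : mser_cvg F f -> mser_cvg G g ->
  mser_cvg (fun N => F N * G N) (f * g).
Proof.
move=> Ff Gg n; rewrite mser_mulE /mser_mul; apply: (cvg_abs_sum absP) => a.
by apply: (cvg_absM absP).
Qed.

Lemma mser_cvg_cst f : mser_cvg (fun=> f) f.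
Proof. by move=> n; apply: (cvg_abs_cst absP). Qed.

Lemma mser_cvg_prod (F : 'I_r -> nat -> mseries r C) (f : 'I_r -> mseries r C) :
  (forall j, mser_cvg (F j) (f j)) ->
  mser_cvg (fun N => \prod_j F j N) (\prod_j f j).
Proof.
move=> Ff; elim: (index_enum _) => [|j s IH].
  by rewrite big_nil; under [X in mser_cvg X]funext do rewrite big_nil; apply: mser_cvg_cst.
by rewrite big_cons; under [X in mser_cvg X]funext do rewrite big_cons; apply: mser_cvgM.
Qed.

Lemma mser_cvg_explin_pX a j :
  mser_cvg (fun N => mser_explin (tail_form ((p ^ N)%:R * a) j)) 1.
Proof.
rewrite -(mser_explin0 r C) => n; rewrite /mser_explin.
apply: (cvg_abs_prod absP) => k; apply: (cvg_absM absP); last exact: (cvg_abs_cst absP).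
apply: (cvg_absX absP).
rewrite /tail_form -(mul0r (a * (j <= k)%N%:R)).
under [X in cvg_abs _ X]funext do rewrite -mulrA.
apply: (cvg_absM absP); last exact: (cvg_abs_cst absP).
apply: (@cvg_abs_le _ _ _ _ absP _ (fun N => p%:R^-1 ^+ N)) => [N|].
  by rewrite subr0 natrX (abs_natX absP).
exact: cvg_exprn0 (ltW (invp_gt0 R p_prime)) (invp_lt1 R p_prime).
Qed.

(** Exchanging sums, sum_i y_i t_i = sum_j x_j T_j: partial sums in x correspond to tails in t. So
    the product of the y_i^n_i / n_i! is a coefficient of prod_j exp (x_j T_j), and the sum over x
    splits into one geometric sum for each j. *)
Lemma moment_generating n gamma eta P : (forall j, eta j != 1) ->
  \sum_(x : {ffun 'I_r -> 'I_P})
    (\prod_i partial_dot gamma (fun j => (x j)%:R) i ^+ n i) *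
    \prod_j (eta j ^+ x j / (1 - eta j ^+ P)) =
  (\prod_(j < r) (n j)`!)%:R *
  (\prod_j (mser_const (1 - eta j ^+ P)^-1 *
     (1 - mser_const (eta j ^+ P) * mser_explin (tail_form (P%:R * gamma j) j))) *
   \prod_j (bernoulli_factor (eta j) (gamma j) j : mseries r C)) n.
Proof.
move=> eta1; set K := (\prod_(j < r) (n j)`!)%:R; rewrite -big_split /=.
under [in RHS]eq_bigr => j _ do rewrite -mulrA -(bernoulli_factor_geometric natr_neq0) // mulr_sumr.
rewrite bigA_distr_bigA mser_sumE mulr_sumr; apply: eq_bigr => x _ /=.
under [in RHS]eq_bigr => j _ do rewrite mulrA -mser_const_mul.
rewrite [in RHS]big_split /= -mser_const_prod (mser_explin_prod natr_neq0) mser_constM.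
rewrite [RHS]mulrCA [RHS]mulrC; congr (_ * _); last by apply: eq_bigr => j _; rewrite mulrC.
rewrite /K /mser_explin big_split /= prodfV natr_prod mulrCA divff ?mulr1.
  apply: eq_bigr => k _; congr (_ ^+ _); rewrite /partial_dot big_mkcond.
  by apply: eq_bigr => j _; rewrite /tail_form; case: leqP; rewrite ?mulr1 // mulr0.
by apply/prodf_neq0 => k _; case: _`! (fact_gt0 (n k)).
Qed.

Lemma moment_cvg n gamma eta : (forall j, abs (eta j) <= 1) ->
  (forall j N, abs (1 - eta j ^+ (p ^ N)) = 1) ->
  cvg_abs abs (fun N => \sum_(x : {ffun 'I_r -> 'I_(p ^ N)})
    (\prod_i partial_dot gamma (fun j => (x j)%:R) i ^+ n i) *
    \prod_j (eta j ^+ x j / (1 - eta j ^+ (p ^ N))))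
  (twisted_bernoulli n eta gamma).
Proof.
move=> eta_le1 eta_far.
have far_neq0 j N : 1 - eta j ^+ (p ^ N) != 0.
  apply/eqP => H; have := eta_far j N; rewrite H (abs0 absP) => /eqP.
  by rewrite eq_sym oner_eq0.
have eta1 j : eta j != 1 by have := far_neq0 j 0%N; rewrite expn0 expr1 subr_eq0 eq_sym.
under [X in cvg_abs _ X]funext do rewrite moment_generating //.
rewrite /twisted_bernoulli; apply: (cvg_absMl absP).
set B : mseries r C := \big[_/_]_(j < r) _.
rewrite -[X in cvg_abs _ _ (X n)](@mul1r (mseries r C) B).
move: n; apply: (@mser_cvgM _ (fun=> B)); last exact: mser_cvg_cst.
have P1 : \prod_(j < r) (1 : mseries r C) = 1 by rewrite big1.
rewrite -[X in mser_cvg _ X]P1.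
apply: mser_cvg_prod => j n.
set E := fun N => mser_explin (tail_form ((p ^ N)%:R * gamma j) j).
(* The quotient in front need not converge, but its absolute value is at most 1, and 1 - E N tends
   to 0. *)
have UE N : (mser_const (1 - eta j ^+ (p ^ N))^-1 *
     (1 - mser_const (eta j ^+ (p ^ N)) * E N)) n =
   (1 : mseries r C) n + (eta j ^+ (p ^ N) / (1 - eta j ^+ (p ^ N))) *
     ((1 : mseries r C) n - E N n).
  rewrite mser_constM mser_addE mser_oppE mser_constM.
  by have := far_neq0 j N; move: (eta j ^+ _) => h h0; field.
apply: (cvg_abs_near (fun N _ => UE N)); rewrite -[X in cvg_abs _ _ X]addr0.
apply: (cvg_absD absP); first exact: (cvg_abs_cst absP).
apply: (cvg_abs_bounded0 absP) => [|N]; last first.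
  by rewrite (absM absP) (absV absP) eta_far invr1 mulr1 (absX absP) exprn_ile1 // (abs_ge0 absP).
rewrite -(subrr ((1 : mseries r C) n)); apply: (cvg_absD absP); first exact: (cvg_abs_cst absP).
have := mser_cvg_explin_pX (gamma j) j n => /(cvg_absMl absP (-1)).
rewrite mulN1r; apply: cvg_abs_near => N _; by rewrite mulN1r.
Qed.

End Moments.

(** * Expansion over increasing tuples *)

Section IncreasingTuples.
Variables (d r : nat).

(** This is the summation condition of the theorem verbatim, so that both index sets agree by
    conversion. *)
Definition increasing (i : {ffun 'I_d -> 'I_r}) :=
  [forall l : 'I_d, forall m : 'I_d, (l < m)%N ==> (i l < i m)%N].

Lemma increasingP (i : {ffun 'I_d -> 'I_r}) :
  reflect (forall l m : 'I_d, (l < m)%N -> (i l < i m)%N) (increasing i).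
Proof.
apply: (iffP forallP) => [H l m|H l]; last by apply/forallP => m; apply/implyP/H.
exact/implyP/(forallP (H l)).
Qed.

Lemma increasing_inj (i : {ffun 'I_d -> 'I_r}) : increasing i -> injective i.
Proof.
move/increasingP => H l m E; apply: val_inj; case: (ltngtP l m) => // /H.
  by rewrite E ltnn.
by rewrite E ltnn.
Qed.

End IncreasingTuples.

Lemma sorted_enum_ord r (A : {set 'I_r}) :
  sorted (fun a b : 'I_r => (a < b)%N) (enum A).
Proof.
rewrite {1}/enum_mem; apply: sorted_filter; first by move=> x y z; apply: ltn_trans.
by rewrite -enumT; have := iota_ltn_sorted 0 r; rewrite -val_enum_ord sorted_map.
Qed.

(** Taking the image and listing the elements in order are mutually inverse. The form [r.+1]
    supplies the default [ord0] for [nth]. *)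
Lemma big_card_increasing (V : nmodType) (d r : nat) (F : {set 'I_r.+1} -> V) :
  \sum_(A : {set 'I_r.+1} | #|A| == d) F A =
  \sum_(i : {ffun 'I_d -> 'I_r.+1} | increasing i) F [set i l | l : 'I_d].
Proof.
pose h (i : {ffun 'I_d -> 'I_r.+1}) := [set i l | l : 'I_d].
pose h' (A : {set 'I_r.+1}) : {ffun 'I_d -> 'I_r.+1} := [ffun l : 'I_d => nth ord0 (enum A) l].
have lt_trans : transitive (fun a b : 'I_r.+1 => (a < b)%N) by move=> x y z; apply: ltn_trans.
have h'_incr (A : {set 'I_r.+1}) : #|A| = d -> increasing (h' A).
  move=> Ad; apply/increasingP => l m lm; rewrite !ffunE.
  by apply: (sorted_ltn_nth lt_trans ord0 (sorted_enum_ord A)); rewrite ?inE -?cardE ?Ad.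
rewrite (reindex_onto h h') => [|A /eqP Ad]; last first.
  apply/setP => x; apply/imsetP/idP => [[l _ ->]|xA].
    by rewrite ffunE -mem_enum mem_nth // -cardE Ad.
  have xd : (index x (enum A) < d)%N by rewrite -Ad cardE index_mem mem_enum.
  by exists (Ordinal xd); rewrite // ffunE nth_index // mem_enum.
apply: eq_bigl => i; apply/andP/idP => [[/eqP hd /eqP <-]|incr]; first exact: h'_incr.
split; first by rewrite card_imset ?card_ord //; apply: increasing_inj.
(* Two strictly sorted lists with the same members are equal. *)
suff E : enum (h i) = [seq i l | l <- enum 'I_d].
  by apply/eqP/ffunP => l; rewrite ffunE E (nth_map l) ?size_enum_ord // nth_ord_enum.
apply: (irr_sorted_eq lt_trans); first by move=> x; apply: ltnn.
- exact: sorted_enum_ord.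
- rewrite sorted_map; apply: (@sub_sorted _ (fun a b : 'I_d => (a < b)%N)).
    by move=> l m; apply: (increasingP _ incr).
  by have := iota_ltn_sorted 0 d; rewrite -val_enum_ord sorted_map.
- move=> x; rewrite mem_enum; apply/imsetP/mapP => -[l _ ->]; exists l => //.
  by rewrite mem_enum.
Qed.

Lemma prod1D_increasing (K : comPzRingType) r (z : 'I_r -> K) :
  \prod_i (1 + z i) = 1 + \sum_(1 <= d < r.+1)
    \sum_(i : {ffun 'I_d -> 'I_r} | increasing i) \prod_l z (i l).
Proof.
case: r z => [|r] z; first by rewrite big_ord0 big_geq // addr0.
under eq_bigr do rewrite addrC.
rewrite (bigA_distr _ _ z (fun=> 1)) /=.
rewrite (eq_bigr (fun A : {set 'I_r.+1} => \prod_(i in A) z i)); last first.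
  by move=> A _; rewrite [RHS]big_mkcond.
(* Subsets are grouped by cardinality, which is at most r + 1, so [inord] into ['I_r.+2] loses
   nothing; the empty set gives the term 1. *)
rewrite (partition_big (fun A : {set 'I_r.+1} => inord #|A| : 'I_r.+2) xpredT) //=.
have cardK (A : {set 'I_r.+1}) : (inord #|A| : 'I_r.+2) = #|A| :> nat.
  by rewrite inordK // ltnS -[X in (_ <= X)%N](card_ord r.+1) max_card.
rewrite big_ord_recl; congr (_ + _).
  rewrite (big_pred1 finset.set0) ?big_set0 // => A.
  by rewrite -(inj_eq val_inj) /= cardK cards_eq0.
rewrite big_add1 big_mkord; apply: eq_bigr => d _.
rewrite (eq_bigl (fun A : {set 'I_r.+1} => #|A| == d.+1)) => [|A]; last first.
  by rewrite -(inj_eq val_inj) /= cardK.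
rewrite (@big_card_increasing _ d.+1); apply: eq_bigr => i /increasing_inj inj_i.
by rewrite big_imset //= => l m _ _; apply: inj_i.
Qed.

(** * Enumerations of finite sets of roots *)

Lemma fsbig_range (V : nmodType) (I : finType) (T : choiceType) (e : I -> T)
    (A : set T) (F : T -> V) : injective e -> (forall z, A z <-> exists i, e i = z) ->
  \sum_(z \in A) F z = \sum_i F (e i).
Proof.
move=> inj_e AE; have -> : A = [set` [seq e i | i <- enum I]]%classic.
  apply/seteqP; split => z /=; [case/AE=> i <-|case/mapP=> i _ ->; by apply/AE; exists i].
  by apply/mapP; exists i; rewrite ?mem_enum.
have us : uniq [seq e i | i <- enum I] by rewrite map_inj_uniq ?enum_uniq.
by rewrite -(fsbig_seq _ _ us) big_map big_enum.
Qed.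

(** Induction on the size, splitting off a linear factor as long as K contains a root. *)
Lemma poly_root_seq (K : idomainType) (P : {poly K}) : P != 0 ->
  exists s : seq K, uniq s /\ forall x, (x \in s) = root P x.
Proof.
move: {2}(size P) (leqnn (size P)) => m; elim: m P => [|m IH] P Pm P0.
  by move: Pm; rewrite leqn0 size_poly_eq0 (negPf P0).
have [[x Px]|noroot] := pselect (exists x, root P x); last first.
  by exists [::]; split=> // x; rewrite in_nil; apply/esym/negP => Px; apply: noroot; exists x.
have /factor_theorem[Q PE] := Px.
have Q0 : Q != 0 by apply: contra_neq P0 => Q0; rewrite PE Q0 mul0r.
have [|s [us sE]] := IH Q _ Q0.
  by move: Pm; rewrite PE size_Mmonic ?monicXsubC // size_XsubC addn2 ltnS.
exists (undup (x :: s)); split=> [|y]; first exact: undup_uniq.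
by rewrite mem_undup inE sE PE rootM root_XsubC orbC.
Qed.

Lemma nontrivial_roots_enum (C : fieldType) c : (0 < c)%N ->
  exists m (e : 'I_m -> C), injective e /\
    forall z, nontrivial_roots c z <-> exists i, e i = z.
Proof.
move=> c0; have [|s [us sE]] := @poly_root_seq C ('X^c - 1).
  by rewrite monic_neq0 // monicXnsubC.
pose t := [seq z <- s | z != 1].
exists (size t), (fun i => tnth (in_tuple t) i); split.
  by apply/tuple_uniqP; rewrite filter_uniq.
move=> z; have -> : nontrivial_roots c z <-> z \in t.
  rewrite mem_filter sE rootE !hornerE subr_eq0.
  split=> [[zc z1]|/andP[z1 /eqP zc]]; last by split.
  by rewrite z1; apply/eqP.
split=> [/(tnthP (in_tuple t))[i ->]|[i <-]]; first by exists i.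
exact: mem_tnth.
Qed.

Lemma nontrivial_root_tuples_enum (C : fieldType) r c m (e : 'I_m -> C) :
    (forall z, nontrivial_roots c z <-> exists i, e i = z) ->
  forall xi : {ffun 'I_r -> C}, nontrivial_root_tuples c xi <->
    exists g : {ffun 'I_r -> 'I_m}, [ffun j => e (g j)] = xi.
Proof.
move=> eE xi; split=> [H|[g <-] j]; last by rewrite ffunE; apply/eE; exists (g j).
have /choice[g gE] : forall j, exists i, e i = xi j by move=> j; apply/eE/H.
by exists [ffun j => g j]; apply/ffunP => j; rewrite !ffunE gE.
Qed.

Lemma ffun_comp_inj (I J : finType) (T : Type) (e : J -> T) : injective e ->
  injective (fun g : {ffun I -> J} => [ffun j => e (g j)]).
Proof.
move=> inj_e g g' /ffunP E; apply/ffunP => j; apply: inj_e.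
by have := E j; rewrite !ffunE.
Qed.

(** * Roots of unity *)

Section RootsOfUnity.
Variables (R : realType) (p : nat) (C : fieldType) (abs : C -> R).
Hypotheses (p_prime : prime p) (absP : is_Cp p abs).

Let abs_ge0 x : 0 <= abs x := abs_ge0 absP x.
Let absM x y : abs (x * y) = abs x * abs y := absM absP x y.
Let natr_neq0 := natr_neq0 p_prime absP.

Lemma p_neq0 : p%:R != 0 :> C.
Proof. by rewrite -(prednK (prime_gt0 p_prime)). Qed.

(** A root of 1 + X + ... + X^(p-1), whose coefficients are natural numbers b and thus roots of X -
    b. Its order divides p and is not 1, since the value at 1 is p, nonzero in C. *)
Lemma prim_root_p_exists : exists z : C, p.-primitive_root z.
Proof.
pose P : {poly C} := \poly_(k < p) 1.
have szP : size P = p by rewrite size_poly_eq // oner_eq0.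
have [||z Pz] := algebraic_closed absP (P := P); first by rewrite szP prime_gt1.
  move=> i; have : exists b : nat, P`_i = b%:R.
    by rewrite coef_poly; case: ifP => _; [exists 1%N|exists 0%N].
  case=> b ->; exists ('X - b%:R%:P); split; last by rewrite root_XsubC.
    by rewrite polyXsubC_eq0.
  move=> k; have -> : ('X - b%:R%:P)`_k =
      (((k == 1%N) : nat)%:Z - (if k == 0%N then b%:Z else 0))%:~R :> C.
    by rewrite coefB coefX coefC rmorphB /=; case: (k == 0%N); case: (k == 1%N).
  exact: (proj1 (padic_int_int p_prime absP _)).
have Sz : \sum_(i < p) z ^+ i = 0.
  by move: Pz; rewrite rootE horner_poly => /eqP Pz;
    rewrite -[RHS]Pz; apply: eq_bigr => i _; rewrite mul1r.
have zp : z ^+ p = 1 by apply/eqP; rewrite -subr_eq0 subrX1 Sz mulr0.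
have [m zm mp] := prim_order_exists (prime_gt0 p_prime) zp.
have [m1|/(prime_nt_dvdP p_prime)/(_ mp) mE] := eqVneq m 1%N; last by exists z; rewrite -mE.
have z1 : z = 1 by have := prim_expr_order zm; rewrite m1 expr1.
case/eqP: p_neq0; rewrite -Sz z1 (eq_bigr (fun=> 1)) => [|i _]; last exact: expr1n.
by rewrite sumr_const card_ord.
Qed.

Section PrimitiveRoot.
Variable z : C.
Hypothesis z_prim : p.-primitive_root z.

Lemma prim_root_exp_inj : injective (fun i : 'I_p => z ^+ i).
Proof.
move=> i j /eqP; rewrite (eq_prim_root_expr z_prim) !modn_small // => /eqP.
exact: val_inj.
Qed.

Lemma prim_root_expP x : x ^+ p = 1 <-> exists i : 'I_p, z ^+ i = x.
Proof.
split=> [/(prim_rootP z_prim)[i ->]|[i <-]]; first by exists i.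
by rewrite -exprM mulnC exprM (prim_expr_order z_prim) expr1n.
Qed.

Lemma prim_root_exprz1 (a : int) : (z ^ a == 1) = (p %| `|a|)%N.
Proof.
case: a => a; first by rewrite -exprnP (prim_order_dvd z_prim).
by rewrite NegzE -exprnN invr_eq1 abszN (prim_order_dvd z_prim).
Qed.

Lemma sum_prim_root_exprz (a : int) :
  \sum_(e < p) (z ^+ e) ^ a = p%:R * (p %| `|a|)%N%:R.
Proof.
under eq_bigr => e _ do rewrite exprnP exprzAC -exprnP.
rewrite -prim_root_exprz1; case: eqP => [->|/eqP za1].
  rewrite (eq_bigr (fun=> 1)) => [|e _]; last exact: expr1n.
  by rewrite sumr_const card_ord mulr1.
rewrite mulr0; apply: (mulfI (_ : z ^ a - 1 != 0)); first by rewrite subr_eq0.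
rewrite -subrX1 mulr0 [_ ^+ p]exprnP exprzAC -exprnP (prim_expr_order z_prim).
by rewrite exp1rz subrr.
Qed.

End PrimitiveRoot.

(** The exponent selected in [root_pow] depends on gamma alone, so one integer serves all rho; this
    makes [root_pow] multiplicative in rho. *)
Lemma root_pow_exprz gamma : padic_int abs gamma ->
  exists2 a : int, padic_multiple abs p (gamma - a%:~R) &
    forall rho, root_pow p abs rho gamma = rho ^ a.
Proof.
move=> gZ; rewrite /root_pow; case: xgetP => [a _ /= ga|H]; first by exists a.
have [b gb] := padic_int_approx p_prime absP 1 gZ; case: (H b%:Z).
rewrite /= -pmulrn -[p in padic_multiple _ p]expn1; apply/(padic_multipleP p_prime absP) => //.
apply: (padic_intD p_prime absP) => //.
exact/(padic_intN p_prime absP)/(padic_int_nat p_prime absP).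
Qed.

(** The powers x^k with k < c sum to 0, so c is the sum of the 1 - x^k. Hence |c| <= |1 - x|, while
    |c| = 1. *)
Lemma abs_one_sub_root c x : (0 < c)%N -> coprime c p -> nontrivial_roots c x -> abs (1 - x) = 1.
Proof.
move=> c0 cp [xc x1]; have ax := abs_root1 absP c0 xc.
apply/eqP; rewrite eq_le (abs_subr_le absP) ?(abs1 absP) ?ax //= leNgt; apply/negP => lt1.
have S0 : \sum_(k < c) x ^+ k = 0.
  apply: (mulfI (_ : x - 1 != 0)); first by rewrite subr_eq0.
  by rewrite -subrX1 xc subrr mulr0.
have : abs c%:R < 1.
  apply: le_lt_trans lt1.
  have -> : c%:R = \sum_(k < c) (1 - x ^+ k) by rewrite sumrB S0 subr0 sumr_const card_ord.
  apply: (abs_sum_le absP) => // -[[|k] /= _] _; first by rewrite subrr (abs0 absP).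
  have := @abs_subrXX _ _ _ _ absP 1 x 1 k; rewrite !expr1n mulr1 (abs1 absP) ax.
  by apply.
by rewrite (abs_nat_coprime p_prime absP) ?ltxx // coprime_sym.
Qed.

Lemma nontrivial_roots_expr c k (x : C) : coprime c k -> nontrivial_roots c x ->
  nontrivial_roots c (x ^+ k).
Proof.
move=> ck [xc x1]; split; first by rewrite -exprM mulnC exprM xc expr1n.
apply: contra_neq x1 => xk.
have [c0|c0] := posnP c.
  by move: ck; rewrite c0 /coprime gcd0n => /eqP k1; move: xk; rewrite k1 expr1.
have [[u v] /= uv] := coprimeP k c0 ck.
have E : (u * c)%N = (1 + v * k)%N by lia.
by have := expr1n C u; rewrite -xc -exprM mulnC E exprD expr1 mulnC exprM xk expr1n mulr1.
Qed.

(** Put w = (theta x)^(p^N). A p-th power removes theta, so |1 - w^p| = 1 by the case of c-th roots;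
    and |1 - w^p| <= |1 - w|. *)
Lemma abs_one_sub_twisted_root c theta x N : (0 < c)%N -> coprime c p ->
  theta ^+ p = 1 -> nontrivial_roots c x -> abs (1 - (theta * x) ^+ (p ^ N)) = 1.
Proof.
move=> c0 cp tp xc; have [x1 _] := xc.
have a1 : abs ((theta * x) ^+ (p ^ N)) = 1.
  rewrite (absX absP) absM (abs_root1 absP (prime_gt0 p_prime) tp).
  by rewrite (abs_root1 absP c0 x1) mulr1 expr1n.
apply/eqP; rewrite eq_le (abs_subr_le absP) ?(abs1 absP) ?a1 //=.
have H : abs (1 - ((theta * x) ^+ (p ^ N)) ^+ p) = 1.
  rewrite -exprM -expnSr exprMn expnS exprM tp expr1n mul1r -expnS.
  by apply: (abs_one_sub_root c0 cp); apply: nontrivial_roots_expr => //; apply: coprimeXr.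
have := @abs_subrXX _ _ _ _ absP 1 ((theta * x) ^+ (p ^ N)) 1 p.-1.
by rewrite (prednK (prime_gt0 p_prime)) !expr1n mulr1 H (abs1 absP) a1; apply.
Qed.

End RootsOfUnity.

(** * Limits of Riemann sums twisted by p-th roots of unity *)

Section TwistedLimit.
Variables (R : realType) (p : nat) (C : fieldType) (abs : C -> R).
Hypotheses (p_prime : prime p) (absP : is_Cp p abs).
Variables (r : nat) (n : 'I_r -> nat) (gamma : 'I_r -> C) (c : nat).
Hypotheses (c_gt0 : (0 < c)%N) (c_coprime : coprime c p).

Definition twisted_riemann_sum (theta : 'I_r -> C) N : C :=
  \sum_(x : {ffun 'I_r -> 'I_(p ^ N)}) (\prod_j theta j ^+ x j) *
    ((\prod_i partial_dot gamma (fun j => (x j)%:R) i ^+ n i) *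
     \prod_j koblitz_measure_sum p C c N (x j)).

(** The measure absorbs the twist: if theta^(p^N) = 1, then theta^x xi^x / (1 - xi^(p^N)) is the
    value of the measure attached to theta xi. The sums over roots multiply out to a sum over
    tuples, and [moment_cvg] applies to each. *)
Lemma twisted_riemann_sum_cvg theta : (forall j, theta j ^+ p = 1) ->
  cvg_abs abs (twisted_riemann_sum theta)
    (\sum_(xi \in nontrivial_root_tuples c)
       twisted_bernoulli n (fun j => theta j * xi j) gamma).
Proof.
move=> theta_p.
have [m [e [inj_e eE]]] := @nontrivial_roots_enum C c c_gt0.
rewrite (fsbig_range _ (ffun_comp_inj inj_e) (nontrivial_root_tuples_enum eE)).
have eR i : nontrivial_roots c (e i) by apply/eE; exists i.
pose eta (g : {ffun 'I_r -> 'I_m}) j := theta j * e (g j).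
have -> : \sum_(g : {ffun 'I_r -> 'I_m})
    twisted_bernoulli n (fun j => theta j * [ffun j => e (g j)] j) gamma =
    \sum_(g : {ffun 'I_r -> 'I_m}) twisted_bernoulli n (eta g) gamma.
  by apply: eq_bigr => g _; congr twisted_bernoulli; apply/funext => j; rewrite ffunE.
apply: (@cvg_abs_near _ _ _ _ (fun N => \sum_(g : {ffun 'I_r -> 'I_m})
    \sum_(x : {ffun 'I_r -> 'I_(p ^ N)})
    (\prod_i partial_dot gamma (fun j => (x j)%:R) i ^+ n i) *
    \prod_j (eta g j ^+ x j / (1 - eta g j ^+ (p ^ N))))); last first.
  apply: (cvg_abs_sum absP) => g; apply: (moment_cvg p_prime absP) => j.
    rewrite (absM absP) (abs_root1 absP (prime_gt0 p_prime) (theta_p j)) mul1r.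
    by rewrite (abs_root1 absP c_gt0) //; case: (eR (g j)).
  by move=> N; apply: (abs_one_sub_twisted_root p_prime absP _ c_gt0 c_coprime).
(* Level 0 is discarded, since theta^(p^0) = theta may differ from 1. *)
move=> [//|N] _; rewrite exchange_big /=; apply: eq_bigr => x _.
rewrite -mulr_sumr mulrCA; congr (_ * _).
under [X in _ * X]eq_bigr do rewrite /koblitz_measure_sum (fsbig_range _ inj_e eE).
rewrite bigA_distr_bigA mulr_sumr; apply: eq_bigr => g _.
rewrite -big_split /=; apply: eq_bigr => j _.
rewrite /koblitz_measure mulrA -exprMn; congr (_ / (1 - _)).
by rewrite [RHS]exprMn [in theta j ^+ _]expnS [theta j ^+ _]exprM theta_p expr1n mul1r.
Qed.

End TwistedLimit.

(** * Riemann sums of the L-function *)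

Section RiemannSum.
Variables (R : realType) (p : nat) (C : fieldType) (abs : C -> R).
Hypotheses (p_prime : prime p) (absP : is_Cp p abs).
Variables (r : nat) (n : 'I_r -> nat) (gamma : 'I_r -> C) (c : nat).
Hypothesis gammaZ : forall j, padic_int abs (gamma j).
Variable z : C.
Hypothesis z_prim : p.-primitive_root z.

Lemma padic_int_partial_dot (x : 'I_r -> C) (i : 'I_r) : (forall j, padic_int abs (x j)) ->
  padic_int abs (partial_dot gamma x i).
Proof.
move=> xZ; rewrite /partial_dot; elim/big_rec: _ => [|j y _ yZ].
  exact: (padic_int_nat p_prime absP 0).
by apply: (padic_intD p_prime absP) => //; apply: (padic_intM p_prime absP).
Qed.

Let rho_pow (e : nat) (j : 'I_r) := root_pow p abs (z ^+ e) (gamma j).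

Lemma padic_multiple_indicator (x : 'I_r -> nat) (i : 'I_r) :
  1 + (- p%:R^-1) * (\sum_(e < p) \prod_(j < r | (j <= i)%N) rho_pow e j ^+ x j) =
  (~~ `[< padic_multiple abs p (partial_dot gamma (fun j => (x j)%:R) i) >])%:R.
Proof.
have /choice[a aP] : forall j, exists a : int, padic_multiple abs p (gamma j - a%:~R) /\
    forall rho, root_pow p abs rho (gamma j) = rho ^ a.
  by move=> j; have [a ga aE] := root_pow_exprz p_prime absP (gammaZ j); exists a.
(* An integer congruent to y_i modulo p, built from the exponents that [root_pow] selects. The
   character sum depends on [A], the domain on y_i. *)
pose A : int := \sum_(j < r | (j <= i)%N) (x j)%:Z * a j.
under eq_bigr => e _.
  under eq_bigr => j _ do rewrite /rho_pow (proj2 (aP j)) exprnP exprz_exp mulrC.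
  over.
have prodE (e : 'I_p) : \prod_(j < r | (j <= i)%N) (z ^+ e) ^ ((x j)%:Z * a j) = (z ^+ e) ^ A.
  have ze : z ^+ e != 0 by rewrite expf_neq0 // (prim_root_eq0 z_prim) -lt0n prime_gt0.
  rewrite /A; elim/big_rec2: _ => [|j u v _ ->]; first by rewrite expr0z.
  by rewrite -expfzDr.
under eq_bigr do rewrite prodE.
rewrite (sum_prim_root_exprz z_prim) mulrA mulNr mulVf ?(p_neq0 p_prime absP) // mulN1r.
set Y := partial_dot _ _ _.
have YZ : padic_int abs Y by apply: padic_int_partial_dot => j; apply: (padic_int_nat p_prime absP).
have YA : abs (Y - A%:~R) <= p%:R^-1 ^+ 1.
  rewrite /Y /A /partial_dot rmorph_sum -sumrB; apply: (abs_sum_le absP) => [|j _].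
    by rewrite exprn_ge0 // ltW // (invp_gt0 R p_prime).
  rewrite rmorphM /= -mulrBr (absM absP).
  apply: (@le_trans _ _ (1 * abs (gamma j - (a j)%:~R))).
    by rewrite ler_wpM2r ?(abs_ge0 absP) // (abs_nat_le1 absP).
  rewrite mul1r; apply/(padic_multipleP p_prime absP); last first.
    by rewrite expn1; case: (aP j).
  apply: (padic_intD p_prime absP) => //.
  by apply: (padic_intN p_prime absP); apply: (padic_int_int p_prime absP).
have -> : `[< padic_multiple abs p Y >] = (p %| `|A|)%N.
  rewrite -{2}[p]expn1 -(abs_int_le_dvd p_prime absP).
  apply/asboolP/idP => [|H].
    rewrite -{1}[p]expn1 => /(padic_multipleP p_prime absP 1 YZ) H.
    rewrite (_ : A%:~R = Y - (Y - A%:~R)); last by ring.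
    exact: (abs_subr_le absP).
  rewrite -[p in padic_multiple _ p]expn1; apply/(padic_multipleP p_prime absP) => //.
  by rewrite -(subrK A%:~R Y); apply: (abs_addr_le absP).
by case: (_ %| _)%N; rewrite ?subrr ?subr0.
Qed.

Let theta d (i : {ffun 'I_d -> 'I_r}) (E : {ffun 'I_d -> 'I_p}) (j : 'I_r) :=
  root_pow p abs (\prod_(l < d | (j <= i l)%N) z ^+ E l) (gamma j).

Lemma theta_expr_p d (i : {ffun 'I_d -> 'I_r}) (E : {ffun 'I_d -> 'I_p}) j :
  theta i E j ^+ p = 1.
Proof.
have [a _ aE] := root_pow_exprz p_prime absP (gammaZ j).
rewrite /theta aE exprnP exprzAC -exprnP -prodrXl.
rewrite big1 ?exp1rz // => l _; rewrite -exprM mulnC exprM (prim_expr_order z_prim).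
exact: expr1n.
Qed.

(** Exchanging the products over l and over j <= i_l collects, for each j, the rho_l with i_l >= j.
    This is the origin of the inner products in the theorem. *)
Lemma prod_indicator d (i : {ffun 'I_d -> 'I_r}) (x : 'I_r -> nat) :
  \prod_l ((- p%:R^-1) * (\sum_(e < p) \prod_(j < r | (j <= i l)%N) rho_pow e j ^+ x j)) =
  (- p%:R^-1) ^+ d * \sum_(E : {ffun 'I_d -> 'I_p}) \prod_j theta i E j ^+ x j.
Proof.
rewrite big_split /= prodr_const card_ord bigA_distr_bigA; congr (_ * _).
apply: eq_bigr => E _; rewrite (exchange_big_dep xpredT) //=; apply: eq_bigr => j _.
rewrite prodrXl; congr (_ ^+ _).
have [a _ aE] := root_pow_exprz p_prime absP (gammaZ j).
rewrite /theta aE; under eq_bigr do rewrite /rho_pow aE.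
elim/big_rec2: _ => [|l u v _ ->]; first by rewrite exp1rz.
by rewrite expfzMl.
Qed.

Lemma padicL_riemann_sum N :
  \sum_(x : {ffun 'I_r -> 'I_(p ^ N)} | `[< padicL_domain p abs gamma (fun j => (x j)%:R) >])
    (\prod_(i < r)
       (padic_pow abs (angle p abs (partial_dot gamma (fun j => (x j)%:R) i)) (- - (n i)%:R) *
        teichmuller p abs (partial_dot gamma (fun j => (x j)%:R) i) ^ (n i)%:Z)) *
    \prod_(j < r) koblitz_measure_sum p C c N (x j) =
  twisted_riemann_sum p n gamma c (fun=> 1) N +
  \sum_(1 <= d < r.+1) (- p%:R^-1) ^+ d *
    \sum_(i : {ffun 'I_d -> 'I_r} | increasing i) \sum_(E : {ffun 'I_d -> 'I_p})
      twisted_riemann_sum p n gamma c (theta i E) N.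
Proof.
pose G (x : {ffun 'I_r -> 'I_(p ^ N)}) := (\prod_i partial_dot gamma (fun j => (x j)%:R) i ^+ n i) *
     \prod_j koblitz_measure_sum p C c N (x j).
transitivity (\sum_(x : {ffun 'I_r -> 'I_(p ^ N)}) (\prod_(i < r) (1 + (- p%:R^-1) *
    (\sum_(e < p) \prod_(j < r | (j <= i)%N) rho_pow e j ^+ x j))) * G x).
  rewrite big_mkcond /=; apply: eq_bigr => x _.
  have xZ j : padic_int abs (x j)%:R := padic_int_nat p_prime absP (x j).
  under [X in _ = X * _]eq_bigr do rewrite padic_multiple_indicator.
  (* On the domain every indicator is 1 and the integrand is the product of the y_i^n_i. The sample
     points are integers, so off the domain p divides some y_i and that indicator is 0. *)
  case: asboolP => [[_ xD]|xD].
    rewrite [X in _ = X * _]big1 => [|i _]; last by case: asboolP => // H; case: (xD i H).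
    rewrite mul1r; congr (_ * _); apply: eq_bigr => i _.
    by rewrite opprK (teichmuller_pow p_prime absP) //; apply: padic_int_partial_dot.
  have [i xi] : exists i, padic_multiple abs p (partial_dot gamma (fun j => (x j)%:R) i).
    by apply: contrapT => H; apply: xD; split=> // i xi; apply: H; exists i.
  by rewrite (bigD1 i) //= asboolT // !mul0r.
under eq_bigr do rewrite prod1D_increasing mulrDl mul1r.
rewrite big_split /=; congr (_ + _).
  apply: eq_bigr => x _; rewrite -[LHS]mul1r; congr (_ * _).
  by rewrite big1 // => j _; rewrite expr1n.
under eq_bigr do rewrite mulr_suml.
rewrite exchange_big /=; apply: eq_bigr => d _.
under eq_bigr do rewrite mulr_suml.
rewrite exchange_big /= mulr_sumr; apply: eq_bigr => i _.
under eq_bigr do rewrite prod_indicator -mulrA mulr_suml.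
by rewrite -mulr_sumr exchange_big.
Qed.

End RiemannSum.

Theorem theorem3p1 (R : realType) (p : nat) (hp : prime p)
    (C : fieldType) (abs : C -> R) (hC : is_Cp p abs)
    (r : nat) (hr : (0 < r)%N) (n : 'I_r -> nat)
    (gamma : 'I_r -> C) (hgamma : forall j, padic_int abs (gamma j))
    (c : nat) (hc : (1 < c)%N) (hcp : coprime c p) :
  padicL p abs (fun i => - (n i)%:R) (fun i => (n i)%:Z) gamma c =
  \sum_(xi \in nontrivial_root_tuples c) twisted_bernoulli n xi gamma +
  \sum_(1 <= d < r.+1) (- p%:R^-1) ^+ d *
    \sum_(i : {ffun 'I_d -> 'I_r} |
        [forall l : 'I_d, forall m : 'I_d, (l < m)%N ==> (i l < i m)%N])
    \sum_(rho \in [set rho : {ffun 'I_d -> C} | forall l, rho l ^+ p = 1]%classic)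
    \sum_(xi \in nontrivial_root_tuples c)
      twisted_bernoulli n
        (fun j => root_pow p abs (\prod_(l < d | (j <= i l)%N) rho l) (gamma j)
                  * xi j)
        gamma.
Proof.
(* The powers of z enumerate the p-th roots of unity by ['I_p], the form in which the Riemann sums
   are expanded. *)
have [z z_prim] := prim_root_p_exists hp hC.
have root_tuplesP d (rho : {ffun 'I_d -> C}) : (forall l, rho l ^+ p = 1) <->
    exists E : {ffun 'I_d -> 'I_p}, [ffun l => z ^+ E l] = rho.
  split=> [H|[E <-] l]; last by rewrite ffunE; apply/(prim_root_expP z_prim); exists (E l).
  have /choice[E EE] : forall l, exists e : 'I_p, z ^+ e = rho l.
    by move=> l; apply/(prim_root_expP z_prim).
  by exists [ffun l => E l]; apply/ffunP => l; rewrite !ffunE EE.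
(* From here on the goal is convergence to the right-hand side, which includes the existence of the
   integral. *)
apply: (lim_absE hC).
under [X in cvg_abs _ X]funext do rewrite (padicL_riemann_sum hp hC n c hgamma z_prim).
apply: (cvg_absD hC).
  (* The untwisted sum is brought to the form of the twisted limit with theta = 1. *)
  have -> : \sum_(xi \in nontrivial_root_tuples c) twisted_bernoulli n xi gamma =
      \sum_(xi \in nontrivial_root_tuples c) twisted_bernoulli n (fun j => 1 * xi j) gamma.
    apply: eq_fsbigr => xi _; congr twisted_bernoulli; apply/funext => j.
    by rewrite mul1r.
  by apply: (twisted_riemann_sum_cvg hp hC) => [|//|j]; rewrite ?expr1n // ltnW.
apply: (cvg_abs_sum hC) => d; apply: (cvg_absMl hC); apply: (cvg_abs_sum hC) => i.
rewrite (fsbig_range _ (ffun_comp_inj (prim_root_exp_inj z_prim)) (root_tuplesP d)).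
apply: (cvg_abs_sum hC) => E.
rewrite (eq_fsbigr (fun xi : {ffun 'I_r -> C} => twisted_bernoulli n (fun j =>
    root_pow p abs (\prod_(l < d | (j <= i l)%N) z ^+ E l) (gamma j) * xi j) gamma)); last first.
  move=> xi _; congr twisted_bernoulli; apply/funext => j.
  by congr (root_pow _ _ _ _ * _); apply: eq_bigr => l _; rewrite ffunE.
have theta_p := theta_expr_p hp hC hgamma z_prim i E.
exact: (twisted_riemann_sum_cvg hp hC n gamma (ltnW hc) hcp theta_p).
Qed.
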